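(* Let $g(u)=\sum_{m\ge 1} g_m u^m$ be an entire function with $g(0)=0$ and $g_1=g'(0)=1$. Assume that $$\lambda := \frac{5}{6} g_{2}^{2} - \frac{3}{4} g_{3} > 0 .$$ Then the equation $$v_{\tau\tau} + v -\varepsilon^{2}(v_{\tau\tau}+v_{\xi\xi})+\sum_{m=2}^{\infty} g_{m} v^{m} = 0$$ has a formal solution of the form $v=\sum_{k=1}^{\infty} \varepsilon^{k} v_{k}(\tau,\xi)$. There are exactly two nonzero such series satisfying the following conditions: (1) all $v_{k}$ are $2\pi$-periodic in $\tau$ and tend to zero as $\xi \rightarrow \pm \infty$; (2) all $v_{k}$ are even in $\tau$ and even in $\xi$. For these series one has: (i) $v_{1} = \pm S \cos \tau$ with $S = \dfrac{\sqrt{2/\lambda}}{\cosh \xi}$ (one choice of sign for each of the two series); (ii) for every $k\ge 1$, the function $v_{k}$ has the form $$v_{k} = \sum_{0 \leq q\leq k} a_{kq}(S) \cos q\tau ,$$ where $a_{kq}$ is a polynomial of degree $\leq k$, vanishes if $k+q$ is odd, has the same parity as $k$, and is always divisible by $S$.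
   Context: The coefficients $g_m$ and the functions $v_k(\tau,\xi)$ are real. A formal solution $v=\sum_{k\ge1}\varepsilon^k v_k(\tau,\xi)$ is a formal power series in $\varepsilon$, with coefficients that are smooth functions of $(\tau,\xi)\in\mathbb{R}^2$, such that after substitution in the equation the coefficient of every power of $\varepsilon$ vanishes identically. (The equation is obtained from $u_{tt}-u_{xx}+g(u)=0$ through $u(x,t)=v$, $\xi=\varepsilon x$, $\tau=\sqrt{1-\varepsilon^2}\,t$.) A polynomial ''has the same parity as $k$'' if it contains only even powers when $k$ is even and only odd powers when $k$ is odd. *)

(* Defs.v *)
From mathcomp Require Import all_boot all_algebra Rstruct.
From Stdlib Require Import Reals.
From Coquelicot Require Import Coquelicot.

(* The argument lists the real coefficients g_m of the nonlinearity. *)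
Definition lambda (gm : nat -> R) : R :=
  (5 / 6 * gm 2%nat ^ 2 - 3 / 4 * gm 3%nat)%R.

Definition soliton (l xi : R) : R := (sqrt (2 / l) / cosh xi)%R.

(* A formal power series in epsilon whose coefficients are functions of
   (tau, xi): [v k tau xi] is the coefficient of epsilon^k. *)
Definition fseries := nat -> R -> R -> R.

Definition smooth (f : R -> R -> R) : Prop :=
  forall (n : nat) (x y : R), ex_diff_n f n x y.

(* m-th power of the power series with coefficients [a]. *)
Fixpoint PS_pow (a : nat -> R) (m : nat) : nat -> R :=
  match m with
  | O => fun n => if n is O then 1%R else 0%R
  | S m' => PS_mult a (PS_pow a m')
  end.

(* Coefficient of epsilon^k, at the point (tau, xi), of
     v_tautau + v - epsilon^2 (v_tautau + v_xixi) + sum_(m >= 2) g_m v^m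
   for a series v without constant term.  The sum over m stops at k because
   v^m then starts at epsilon^m, so that terms with m > k do not contribute
   ([sum_n_m _ 2 k] is 0 for k < 2). *)
Definition equation_coeff (gm : nat -> R) (v : fseries) (k : nat)
    (tau xi : R) : R :=
  (Derive_n (fun t => v k t xi) 2 tau + v k tau xi
   - PS_incr_n (fun j => Derive_n (fun t => v j t xi) 2 tau
                         + Derive_n (fun x => v j tau x) 2 xi) 2 k
   + sum_n_m (fun m => gm m * PS_pow (fun j => v j tau xi) m k) 2 k)%R.

Definition formal_solution (gm : nat -> R) (v : fseries) : Prop :=
  (forall tau xi : R, v 0%nat tau xi = 0%R) /\
  (forall k : nat, smooth (v k)) /\
  (forall (k : nat) (tau xi : R), equation_coeff gm v k tau xi = 0%R).

Definition nonzero_series (v : fseries) : Prop :=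
  exists (k : nat) (tau xi : R), v k tau xi <> 0%R.

Definition periodic_decaying (v : fseries) : Prop :=
  forall k : nat,
    (forall tau xi : R, v k (tau + 2 * PI)%R xi = v k tau xi) /\
    (forall tau : R, is_lim (fun xi => v k tau xi) p_infty 0%R /\
                     is_lim (fun xi => v k tau xi) m_infty 0%R).

Definition even_even (v : fseries) : Prop :=
  forall (k : nat) (tau xi : R),
    v k (- tau)%R xi = v k tau xi /\ v k tau (- xi)%R = v k tau xi.

Section Coefficients.
Import GRing.Theory.
Local Open Scope ring_scope.

Definition same_parity (k : nat) (p : {poly R}) : Prop :=
  forall i : nat, p`_i != 0 -> odd i = odd k.

Definition admissible_coeff (k q : nat) (p : {poly R}) : Prop :=
  [/\ (size p <= k.+1)%nat, odd (k + q) -> p = 0, same_parity k p & 'X %| p].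

End Coefficients.

Definition has_soliton_expansion (l : R) (k : nat) (f : R -> R -> R) : Prop :=
  exists a : nat -> {poly R},
    (forall q : nat, (q <= k)%nat -> admissible_coeff k q (a q)) /\
    (forall tau xi : R,
       f tau xi =
       sum_n (fun q => Rmult (horner (a q) (soliton l xi))
                             (cos (INR q * tau)%R)) k).

(* Main.v *)
(* A solution is determined order by order in epsilon.  Cancelling the resonant
   term cos(tau) at order 3 gives v_1 = a(xi) cos(tau) with
   a'' = a - lambda a^3, whose even decaying solutions are 0 and +-S.  If two
   solutions first differ at order k >= 2, they differ there by b(xi) cos(tau),
   and cancelling the resonant term at order k + 2 gives
   b'' = b - 3 lambda a^2 b, which has no nonzero even decaying solution; this
   is uniqueness.  For existence, all coefficients are kept in the span of the
   functions S^i cos(q tau): the range of the oscillator u'' + u on this span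
   misses only the first harmonic, and the linearized soliton operator maps
   S^j to a combination of S^j and S^(j+2) that is invertible on the odd powers
   that occur.  The parity of i and q forces the resonant term to vanish at
   even orders. *)

(* The multiple of cos(tau) in v_k is settled only by the equation at order k + 2, and adjusting it
   disturbs order k + 1 as well. The existence induction therefore carries a lag: the equation is
   exact up to some order, merely solvable at the next, and only the lower coefficients are final. A
   change of v_k reaches v^m from order m + k - 1 on, so the two orders concerned see it only
   through g_2 and g_3. This is why lambda contains no other coefficient: v_2 responds to g_2 v_1^2
   by -g_2 a^2 (2/3 - cos^2/3), the first harmonic of cos^3 is 3/4 cos, and 4/3 - (3/4)(2/3) = 5/6.
   The obstacle to staying among polynomials in S is that the linearized operator sends odd powers
   of S into the span of S^3, S^5, ..., so a forcing S cos(tau) could not be removed. It never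
   occurs: v_tautau + v_xixi multiplies S^i cos(q tau) by i^2 - q^2, up to a term in S^(i+2), and
   v^m with m >= 2 is divisible by S^2. *)
Require Import Defs.
From mathcomp Require Import all_boot all_algebra Rstruct zify.
From Stdlib Require Import Reals Lra FunctionalExtensionality IndefiniteDescription.
From Coquelicot Require Import Coquelicot.

(** * Powers of formal series under a perturbation of their coefficients *)

Section PowerSeries.
Import GRing.Theory.
Local Open Scope ring_scope.

(** Low coefficients of a power depend only on low coefficients of the base, so formal series can be
    replaced by polynomials, where factorizations of differences of powers are available. *)
Lemma PS_pow_coef (a : nat -> R) (P : {poly R}) (N : nat) :
  (forall n, (n <= N)%nat -> P`_n = a n) ->
  forall m n, (n <= N)%nat -> PS_pow a m n = (P ^+ m)`_n.
Proof.
move=> Pa; elim=> [|m IH] n le_nN; first by rewrite expr0 coef1; case: n le_nN.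
rewrite /= /PS_mult sum_f_R0E big_mkord exprS coefM; apply: eq_bigr => i _.
have := ltn_ord i; rewrite ltnS => le_in.
by rewrite RmultE minusE Pa ?IH //; lia.
Qed.

Lemma shifted_poly (a : nat -> R) (N n : nat) : a 0%nat = 0 -> (n <= N)%nat ->
  ('X * \poly_(i < N) a i.+1)`_n = a n.
Proof. by case: n => [|n] a0 le_nN; rewrite coefXM //= coef_poly le_nN. Qed.

(* a and a' differ by X^k D with D = d_0 + d_1 X + ..., and a = X B, so
   a'^m - a^m = X^(m + k - 1) (...). *)
Lemma PS_pow_perturb (a a' : nat -> R) (k : nat) :
  a 0%nat = 0 -> (1 < k)%nat -> (forall j, (j < k)%nat -> a' j = a j) ->
  [/\ forall m n, (n.+1 < m + k)%nat -> (n <= k.+2)%nat -> PS_pow a' m n = PS_pow a m n,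
      (PS_pow a' 2 k.+1 = PS_pow a 2 k.+1 + 2 * a 1%nat * (a' k - a k))%R,
      (PS_pow a' 2 k.+2 = PS_pow a 2 k.+2 + 2 * a 1%nat * (a' k.+1 - a k.+1)
         + (a' k - a k) * (2 * a 2%nat + (if k == 2%nat then a' k - a k else 0)))%R &
      (PS_pow a' 3 k.+2 = PS_pow a 3 k.+2 + 3 * a 1%nat ^ 2 * (a' k - a k))%R].
Proof.
move=> a0 k_gt1 agree; pose N := k.+2.
pose B := \poly_(i < N) a i.+1; pose D := \poly_(i < N.+1) (a' (k + i)%nat - a (k + i)%nat)%R.
have aB := fun i => @shifted_poly a N i a0.
pose Y := 'X^(k.-1) * D; pose P' : {poly R} := 'X * (B + Y).
have aP' i : (i <= N)%nat -> P'`_i = a' i.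
  move=> le_iN; rewrite /P' mulrDr mulrA -exprS prednK ?(ltnW k_gt1) //.
  rewrite coefD aB // coefXnM; case: ltnP => [/agree-> | le_ki]; first exact: addr0.
  rewrite coef_poly subnKC // ifT ?subrKC //; rewrite /N; lia.
(* The cofactor in the factorization of (B + Y)^m - B^m, with the factor X^(k-1) of Y taken out. *)
pose Q m : {poly R} := D * \sum_(i < m) (B + Y) ^+ (m.-1 - i) * B ^+ i.
have diff m n : (n <= N)%nat ->
    PS_pow a' m n = (PS_pow a m n + ('X^(m + k.-1) * Q m)`_n)%R.
  move=> le_nN; rewrite (PS_pow_coef _ _ _ aP') // (PS_pow_coef _ _ _ aB) // RplusE -coefD.
  suff E : (B + Y) ^+ m = B ^+ m + 'X^(k.-1) * Q m.
    by congr (_`_n); rewrite !exprMn exprD -mulrA -mulrDr E.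
  have := subrXX (B + Y) B m; rewrite addrAC subrr add0r /Y -mulrA => /eqP.
  by rewrite subr_eq => /eqP->; rewrite addrC.
have D0 : D`_0 = (a' k - a k)%R by rewrite coef_poly /= addn0.
have D1 : D`_1 = (a' k.+1 - a k.+1)%R by rewrite coef_poly /= addn1.
have B0 : B`_0 = a 1%nat by rewrite coef_poly.
have B1 : B`_1 = a 2%nat by rewrite coef_poly.
have Y0 : Y`_0 = 0 by rewrite coefXnM ifT //; lia.
(* Y = X^(k-1) D reaches degree 1 only for k = 2; this is the source of the quadratic
   self-interaction in the third claim. *)
have Y1 : Y`_1 = if k == 2%nat then (a' k - a k)%R else 0.
  rewrite coefXnM; case: eqP => [k2|k2]; last by rewrite ifT //; lia.
  by rewrite ifF ?k2 //= D0 k2.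
have Q2 : Q 2%nat = D * (B + Y + B).
  by rewrite /Q !big_ord_recl big_ord0 /= /bump /= expr0 !expr1 mul1r mulr1 addr0.
split=> [m n lt_n le_n|||].
- rewrite diff // coefXnM ifT ?Rplus_0_r //; lia.
- rewrite diff //  coefXnM (_ : (k.+1 - (2 + k.-1) = 0)%nat) ?ifF ?Q2; try lia.
  rewrite coef0M !coefD D0 B0 Y0 -?RplusE -?RmultE -[0]/R0.
    ring.
- rewrite diff // coefXnM (_ : ((k.+2 < 2 + k.-1) = false)%nat); last by lia.
  rewrite (_ : (k.+2 - (2 + k.-1) = 1)%nat) ?Q2; last by lia.
  rewrite coefM !big_ord_recl big_ord0 !coefD D0 D1 B0 B1 Y0 Y1.
  move: (PS_pow a 2 _) => p /=; case: ifP => _; rewrite -?RplusE -?RmultE -[0]/R0; ring.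
- rewrite diff // coefXnM (_ : (k.+2 - (3 + k.-1) = 0)%nat) ?ifF; try lia.
  rewrite /Q coef0M !big_ord_recl big_ord0; move: (PS_pow a 3 _) => p /=.
  rewrite /bump /= !expr0 !expr1 mulr1 mul1r addr0.
  rewrite !coefD ?expr2 !coef0M !coefD D0 B0 Y0 -?RplusE -?RmultE -[0]/R0; ring.
Qed.
End PowerSeries.

(* Goals left by [auto_derive] and [is_derive] rules are equations in a
   normed module carrier that [ring] does not recognize as R. *)
Ltac Rring := match goal with |- @eq _ ?x ?y => change (@eq R x y) end; ring.

(** * Second derivatives, linear second-order equations and decay at infinity *)

Section SecondDerivatives.
Local Open Scope R_scope.

(** [Derive_n] is total and has a default value where no derivative exists. This relation records
    genuine differentiability, so that linearity and uniqueness need no side conditions. *)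
Definition has_d2 (f f2 : R -> R) : Prop :=
  exists f1 : R -> R, (forall x : R, is_derive f x (f1 x)) /\ (forall x : R, is_derive f1 x (f2 x)).

Lemma has_d2_Derive_n f f2 x : has_d2 f f2 -> Derive_n f 2 x = f2 x.
Proof.
move=> [f1 [H1 H2]]; rewrite /= (Derive_ext _ f1) ?(is_derive_unique _ _ _ (H2 x)) // => t.
exact/is_derive_unique.
Qed.

Lemma has_d2_plus f g f2 g2 :
  has_d2 f f2 -> has_d2 g g2 -> has_d2 (fun x => f x + g x) (fun x => f2 x + g2 x).
Proof.
move=> [f1 [Hf1 Hf2]] [g1 [Hg1 Hg2]]; exists (fun x => f1 x + g1 x).
by split=> x; apply: is_derive_plus.
Qed.

Lemma has_d2_scal c f f2 : has_d2 f f2 -> has_d2 (fun x => c * f x) (fun x => c * f2 x).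
Proof.
move=> [f1 [Hf1 Hf2]]; exists (fun x => c * f1 x).
by split=> x; apply: is_derive_scal.
Qed.

Lemma has_d2_minus f g f2 g2 :
  has_d2 f f2 -> has_d2 g g2 -> has_d2 (fun x => f x - g x) (fun x => f2 x - g2 x).
Proof.
move=> [f1 [Hf1 Hf2]] [g1 [Hg1 Hg2]]; exists (fun x => f1 x - g1 x).
by split=> x; apply: is_derive_minus.
Qed.

Lemma has_d2_eq f g f2 g2 :
  has_d2 f f2 -> (forall x, f x = g x) -> (forall x, f2 x = g2 x) -> has_d2 g g2.
Proof.
by move=> H /functional_extensionality<- /functional_extensionality<-.
Qed.

Lemma has_d2_unique f f2 g2 x : has_d2 f f2 -> has_d2 f g2 -> f2 x = g2 x.
Proof. by move=> Hf Hg; rewrite -(has_d2_Derive_n _ _ _ Hf) (has_d2_Derive_n _ _ _ Hg). Qed.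

Lemma derive_nonpos_decr f df a b :
  (forall x, is_derive f x (df x)) -> (forall x, df x <= 0) -> a <= b -> f b <= f a.
Proof.
move=> Hf Hdf ab; have [||c [_ E]] := MVT_gen f a b df.
- by move=> x _; apply: Hf.
- by move=> x _; apply/continuity_pt_filterlim/ex_derive_continuous; exists (df x).
by have := Hdf c; nra.
Qed.

Lemma derive_0_const f x y : (forall x, is_derive f x 0) -> f x = f y.
Proof.
move=> Hf; have [||c [_ E]] := MVT_gen f y x (fun _ => 0).
- by move=> t _; apply: Hf.
- by move=> t _; apply/continuity_pt_filterlim/ex_derive_continuous; exists 0.
lra.
Qed.

(* Gronwall for the energy w^2 + w'^2, whose derivative 2 (1 + c) w w' is
   bounded by (1 + K) (w^2 + w'^2). *)
Lemma linear_ode_unique w w1 c K :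
  (forall x, is_derive w x (w1 x)) -> (forall x, is_derive w1 x (c x * w x)) ->
  (forall x, Rabs (c x) <= K) -> w 0 = 0 -> w1 0 = 0 -> forall x, w x = 0.
Proof.
move=> Hw Hw1 HK w0 w10.
pose e x := w x * w x + w1 x * w1 x.
have He x : is_derive e x (2 * (1 + c x) * (w x * w1 x)).
  apply: (is_derive_ext (fun x => w x * w x + w1 x * w1 x)) => //.
  have := Hw x; have := Hw1 x => H1 H0.
  evar_last; first by apply: is_derive_plus; apply: is_derive_mult;
    [exact: H0|exact: H0|exact: Rmult_comm|exact: H1|exact: H1|exact: Rmult_comm].
  rewrite /plus /mult /=; Rring.
have bound x : Rabs (2 * (1 + c x) * (w x * w1 x)) <= (1 + K) * e x.
  rewrite Rabs_mult Rabs_mult Rabs_mult (Rabs_pos_eq 2); last lra.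
  have h1 : Rabs (1 + c x) <= 1 + K.
    apply: Rle_trans (Rabs_triang _ _) _; rewrite Rabs_R1; have := HK x; lra.
  have h2 : 2 * (Rabs (w x) * Rabs (w1 x)) <= e x.
    have := Rsqr_abs (w x); have := Rsqr_abs (w1 x); rewrite /e /Rsqr => -> ->.
    have := Rle_0_sqr (Rabs (w x) - Rabs (w1 x)); rewrite /Rsqr; lra.
  have h3 := Rabs_pos (1 + c x).
  have h4 : 0 <= 2 * (Rabs (w x) * Rabs (w1 x)).
    by have := Rabs_pos (w x); have := Rabs_pos (w1 x); nra.
  by have := Rmult_le_compat _ _ _ _ h3 h4 h1 h2; lra.
(* One weight for both directions: r = -(1 + K) makes e exp(r t) nonincreasing, which serves x >= 0,
   and r = 1 + K makes it nondecreasing, which serves x < 0. *)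
have dexp r x : is_derive (fun t => e t * exp (r * t)) x
    ((2 * (1 + c x) * (w x * w1 x) + r * e x) * exp (r * x)).
  have h : is_derive (fun t => exp (r * t)) x (r * exp (r * x)) by auto_derive => //; Rring.
  evar_last; first by apply: is_derive_mult; [exact: He|exact: h|exact: Rmult_comm].
  rewrite /plus /mult /=; Rring.
have epos x : e x <= 0.
  have e0 : e 0 = 0 by rewrite /e w0 w10; ring.
  have [x0|x0] := Rle_or_lt 0 x.
    have := derive_nonpos_decr _ _ 0 x (dexp (- (1 + K))) _ x0; rewrite e0 => h.
    have := exp_pos (- (1 + K) * x).
    have {}h : e x * exp (- (1 + K) * x) <= 0 * exp (- (1 + K) * 0).
      apply: h => t; have := bound t; have := exp_pos (- (1 + K) * t).
      have := Rle_abs (2 * (1 + c t) * (w t * w1 t)); nra.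
    nra.
  have xle0 : x <= 0 by lra.
  pose d t := - ((2 * (1 + c t) * (w t * w1 t) + (1 + K) * e t) * exp ((1 + K) * t)).
  have dopp t : is_derive (fun t => - (e t * exp ((1 + K) * t))) t (d t).
    exact: is_derive_opp (dexp (1 + K) t).
  have h : - (e 0 * exp ((1 + K) * 0)) <= - (e x * exp ((1 + K) * x)).
    apply: (derive_nonpos_decr _ _ x 0 dopp _ xle0) => t; rewrite /d.
    have := bound t; have := exp_pos ((1 + K) * t).
    have := Rle_abs (- (2 * (1 + c t) * (w t * w1 t))); rewrite Rabs_Ropp; nra.
  have := exp_pos ((1 + K) * x); rewrite e0 in h; nra.
by move=> x; have := epos x; rewrite /e => h; nra.
Qed.

Lemma harmonic_ode u u2 : has_d2 u u2 -> (forall t, u2 t = - u t) ->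
  exists p q, forall t, u t = p * cos t + q * sin t.
Proof.
move=> [u1 [H1 H2]] E; exists (u 0), (u1 0) => t.
apply: Rminus_diag_uniq.
pose w t := u t - (u 0 * cos t + u1 0 * sin t).
pose w1 t := u1 t - (- u 0 * sin t + u1 0 * cos t).
apply: (linear_ode_unique w w1 (fun _ => -1) 1) => [x|x|x||]; rewrite ?/w ?/w1.
- apply: is_derive_minus; first exact: H1.
  by auto_derive => //; Rring.
- evar_last; first apply: is_derive_minus; first exact: H2.
  - by auto_derive.
  by rewrite E /w /minus /plus /opp /=; Rring.
- by rewrite Rabs_Ropp Rabs_R1; lra.
- by rewrite cos_0 sin_0; Rring.
by rewrite cos_0 sin_0; Rring.
Qed.

Lemma harmonic_even u u2 : has_d2 u u2 -> (forall t, u2 t = - u t) ->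
  (forall t, u (- t) = u t) -> forall t, u t = u 0 * cos t.
Proof.
move=> H E ev t; have [p [q Epq]] := harmonic_ode _ _ H E.
have := ev (PI / 2); rewrite !Epq cos_neg sin_neg cos_PI2 sin_PI2 cos_0 sin_0 => h.
have -> : q = 0 by lra.
ring.
Qed.

(* The particular solution contains the secular term (A1 + 3/4 A3) t sin t / 2. *)
Lemma resonance h h2 A0 A1 A2 A3 : has_d2 h h2 ->
  (forall t, h2 t + h t = A0 + A1 * cos t + A2 * cos t ^ 2 + A3 * cos t ^ 3) ->
  (forall t, h (t + 2 * PI) = h t) -> A1 + 3 / 4 * A3 = 0.
Proof.
move=> Hh E per.
pose b := A1 + 3 / 4 * A3.
(* Since (cos^3)'' + cos^3 = 6 cos - 8 cos^3, the term -A3 cos^3 / 8 produces A3 cos^3 - 3/4 A3 cos.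
   The first harmonic left over is b cos, and b t sin t / 2 produces it. *)
pose s t := A0 + A2 * (2 / 3 - cos t ^ 2 / 3) - A3 * cos t ^ 3 / 8 + b * t * sin t / 2.
pose s2 t := A0 + A1 * cos t + A2 * cos t ^ 2 + A3 * cos t ^ 3 - s t.
have Hs : has_d2 s s2.
  exists (fun t => A2 * (2 * cos t * sin t / 3) + A3 * 3 * cos t ^ 2 * sin t / 8
                   + b * sin t / 2 + b * t * cos t / 2).
  have sin2 t : sin t ^ 2 = 1 - cos t ^ 2 by have := sin2_cos2 t; rewrite /Rsqr; lra.
  split=> t; rewrite /s /s2 /s; auto_derive => //; rewrite /b; first by field.
  have := sin2 t => {}sin2; field [sin2].
have [|p [q Epq]] := harmonic_ode _ _ (has_d2_minus _ _ _ _ Hh Hs).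
  move=> t; have := E t; rewrite /s2; lra.
(* At these two points cos = 0 and sin = 1, so by periodicity of h the two values of [s] agree; they
   differ by b PI. *)
have := Epq (PI / 2); have := Epq (PI / 2 + 2 * PI).
rewrite per /s !cos_plus !sin_plus cos_PI2 sin_PI2 cos_2PI sin_2PI => e1 e2.
have := PI_RGT_0; rewrite -/b; nra.
Qed.

Lemma lim0P f : is_lim f p_infty 0 <->
  forall eps, 0 < eps -> exists M, forall x, M < x -> Rabs (f x) < eps.
Proof.
split.
  move=> /is_lim_spec H eps eps0; have [M HM] := H (mkposreal eps eps0).
  by exists M => x /HM /=; rewrite Rminus_0_r.
move=> H; apply/is_lim_spec => -[eps eps0]; have [M HM] := H eps eps0.
by exists M => x /HM /=; rewrite Rminus_0_r.
Qed.

Lemma lim0_plus f g : is_lim f p_infty 0 -> is_lim g p_infty 0 ->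
  is_lim (fun x => f x + g x) p_infty 0.
Proof.
move=> /lim0P Hf /lim0P Hg; apply/lim0P => eps eps0.
have [|M HM] := Hf (eps / 2); first lra.
have [|N HN] := Hg (eps / 2); first lra.
exists (Rmax M N) => x xMN; apply: Rle_lt_trans (Rabs_triang _ _) _.
have := HM x (Rle_lt_trans _ _ _ (Rmax_l M N) xMN).
have := HN x (Rle_lt_trans _ _ _ (Rmax_r M N) xMN); lra.
Qed.

Lemma lim0_mult_bounded f g M K : is_lim f p_infty 0 ->
  (forall x, M < x -> Rabs (g x) <= K) -> is_lim (fun x => g x * f x) p_infty 0.
Proof.
move=> /lim0P Hf Hg; apply/lim0P => eps eps0.
have K0 : 0 <= K by have := Hg (M + 1) ltac:(lra); have := Rabs_pos (g (M + 1)); lra.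
have [|N HN] := Hf (eps / (K + 1)); first by apply: Rdiv_lt_0_compat; lra.
exists (Rmax M N) => x xMN; rewrite Rabs_mult.
have h1 := Hg x (Rle_lt_trans _ _ _ (Rmax_l M N) xMN).
have h2 := HN x (Rle_lt_trans _ _ _ (Rmax_r M N) xMN).
have h3 : (K + 1) * (eps / (K + 1)) = eps by field; lra.
have := Rabs_pos (f x); have := Rabs_pos (g x); nra.
Qed.

Lemma lim0_mult f g : is_lim f p_infty 0 -> is_lim g p_infty 0 ->
  is_lim (fun x => g x * f x) p_infty 0.
Proof.
move=> Hf /lim0P Hg; have [|M HM] := Hg 1; first lra.
by apply: (lim0_mult_bounded _ _ M 1 Hf) => x /HM; lra.
Qed.

Lemma lim0_scal c f : is_lim f p_infty 0 -> is_lim (fun x => c * f x) p_infty 0.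
Proof. by move=> Hf; apply: (lim0_mult_bounded _ _ 0 (Rabs c) Hf) => x _; apply: Rle_refl. Qed.

Lemma lim0_const_eq0 f c : (forall x, f x = c) -> is_lim f p_infty 0 -> c = 0.
Proof.
move=> Hc Hf; have Hf' : is_lim f p_infty c.
  by apply: (is_lim_ext (fun _ => c)) => [x|]; [rewrite Hc|apply: is_lim_const].
by move: (is_lim_unique _ _ _ Hf) (is_lim_unique _ _ _ Hf') => -> [].
Qed.

(** On [x, x + 1] the mean value theorem gives a point c where f' equals f(x + 1) - f(x), which is
    small; from c back to x, f' changes by at most a value of f''. These three small quantities
    account for eps / 3. *)
Lemma lim0_derive f f1 f2 :
  (forall x, is_derive f x (f1 x)) -> (forall x, is_derive f1 x (f2 x)) ->
  is_lim f p_infty 0 -> is_lim f2 p_infty 0 -> is_lim f1 p_infty 0.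
Proof.
move=> H1 H2 /lim0P Hf /lim0P Hf2; apply/lim0P => eps eps0.
have [|M HM] := Hf (eps / 3); first lra.
have [|N HN] := Hf2 (eps / 3); first lra.
exists (Rmax M N) => x xMN.
have xM := Rle_lt_trans _ _ _ (Rmax_l M N) xMN.
have xN := Rle_lt_trans _ _ _ (Rmax_r M N) xMN.
have MVT u v g dg : (forall t, is_derive g t (dg t)) -> u <= v ->
    exists c, u <= c <= v /\ g v - g u = dg c * (v - u).
  move=> Hg uv; have [||c] := MVT_gen g u v dg.
  - by move=> t _; apply: Hg.
  - by move=> t _; apply/continuity_pt_filterlim/ex_derive_continuous; exists (dg t).
  by rewrite Rmin_left // Rmax_right //; exists c.
have [|c [c1 E1]] := MVT x (x + 1) f f1 H1; first lra.
have [|d [d1 E2]] := MVT x c f1 f2 H2; first lra.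
have h1 := HM (x + 1) ltac:(lra); have h2 := HM x xM; have h3 := HN d ltac:(lra).
move: h1 h2 h3 => /Rabs_def2 [h1 h1'] /Rabs_def2 [h2 h2'] /Rabs_def2 [h3 h3'].
apply: Rabs_def1; nra.
Qed.

Lemma even_derive_0 f f1 : (forall x, is_derive f x (f1 x)) ->
  (forall x, f (- x) = f x) -> f1 0 = 0.
Proof.
move=> H ev; have h : is_derive (fun x => f (- x)) 0 (- f1 0).
  evar_last; first apply: (is_derive_comp f (fun x => - x)).
  - by rewrite Ropp_0; apply: H.
  - by auto_derive.
  by rewrite /scal /= /mult /=; Rring.
have := is_derive_unique _ _ _ (H 0); have := is_derive_unique _ _ _ h.
rewrite (Derive_ext _ f) // => -> e; lra.
Qed.
End SecondDerivatives.

(** * The soliton profile, its characterization and its linearized equation *)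

Section Soliton.
Local Open Scope R_scope.
Variable l : R.
Hypothesis l_gt0 : 0 < l.
Let S := soliton l.
Let T x := sinh x / cosh x.

Lemma cosh_gt0 x : 0 < cosh x.
Proof. by rewrite /cosh; have := exp_pos x; have := exp_pos (- x); lra. Qed.

Lemma cosh2_sinh2 x : cosh x ^ 2 - sinh x ^ 2 = 1.
Proof.
have e : exp x * exp (- x) = 1 by rewrite -exp_plus Rplus_opp_r exp_0.
by rewrite -e /cosh /sinh; field.
Qed.

Lemma cosh_even x : cosh (- x) = cosh x.
Proof. by rewrite /cosh Ropp_involutive Rplus_comm. Qed.

Lemma soliton_even x : S (- x) = S x.
Proof. by rewrite /S /soliton cosh_even. Qed.

Lemma amplitude_sqr : sqrt (2 / l) ^ 2 = 2 / l.
Proof. by apply: pow2_sqrt; apply: Rlt_le; apply: Rdiv_lt_0_compat; lra. Qed.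

Lemma amplitude_gt0 : 0 < sqrt (2 / l).
Proof. by apply: sqrt_lt_R0; apply: Rdiv_lt_0_compat; lra. Qed.

Lemma soliton_gt0 x : 0 < S x.
Proof. by apply: Rdiv_lt_0_compat; [exact: amplitude_gt0 | exact: cosh_gt0]. Qed.

(** As S' = -S T, this relation turns every second derivative of a power of S into a polynomial in
    S. *)
Lemma soliton_tanh x : T x ^ 2 = 1 - l / 2 * S x ^ 2.
Proof.
have -> : S x ^ 2 = 2 / l / cosh x ^ 2.
  by rewrite -amplitude_sqr /S /soliton; field; have := cosh_gt0 x; lra.
have := cosh2_sinh2 x; rewrite /T => e.
have -> : sinh x / cosh x = sinh x * / cosh x by [].
rewrite Rpow_mult_distr; have -> : sinh x ^ 2 = cosh x ^ 2 - 1 by lra.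
field; have := cosh_gt0 x; lra.
Qed.

Lemma soliton_sqr_le x : S x ^ 2 <= 2 / l.
Proof.
have := soliton_tanh x; have := pow2_ge_0 (T x) => h e.
have -> : S x ^ 2 = 2 / l * (1 - T x ^ 2) by rewrite e; field; lra.
have : 0 < 2 / l by apply: Rdiv_lt_0_compat; lra.
nra.
Qed.

Lemma tanh_bound x : Rabs (T x) <= 1.
Proof.
have := soliton_tanh x; have := pow2_ge_0 (S x) => h e.
by apply: Rabs_le; nra.
Qed.

Lemma is_derive_soliton x : is_derive S x (- (S x * T x)).
Proof.
rewrite /S /soliton /T; have := cosh_gt0 x; rewrite /cosh /sinh => h.
by auto_derive; [lra | field; lra].
Qed.

Lemma is_derive_tanh x : is_derive T x (1 - T x ^ 2).
Proof.
rewrite /T; have := cosh_gt0 x; rewrite /cosh /sinh => h.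
by auto_derive; [lra | field; lra].
Qed.

(** The differentiated function is S', so this is the profile equation S'' = S - l S^3. *)
Lemma is_derive_soliton_tanh x :
  is_derive (fun y => - (S y * T y)) x (S x - l * S x ^ 3).
Proof.
evar_last.
  apply: is_derive_opp; apply: is_derive_mult;
    [exact: is_derive_soliton | exact: is_derive_tanh | exact: Rmult_comm].
rewrite /opp /plus /mult /=; match goal with |- @eq _ ?x ?y => change (@eq R x y) end.
transitivity (S x * (2 * T x ^ 2 - 1)); first by Rring.
by rewrite soliton_tanh; field.
Qed.

Lemma soliton_lim0 : is_lim S p_infty 0.
Proof.
apply/lim0P => eps eps0; exists (2 * sqrt (2 / l) / eps) => x Hx.
have A0 := amplitude_gt0.
have x0 : 0 < x by apply: Rle_lt_trans Hx; apply: Rlt_le; apply: Rdiv_lt_0_compat; lra.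
rewrite Rabs_pos_eq; last exact/Rlt_le/soliton_gt0.
apply/Rlt_div_l; first exact: cosh_gt0.
have h : x / 2 < cosh x.
  by rewrite /cosh; have := exp_ineq1 x ltac:(lra); have := exp_pos (- x); lra.
have {}Hx : sqrt (2 / l) < eps * (x / 2).
  by move: Hx => /Rlt_div_l => /(_ eps0); lra.
nra.
Qed.

Lemma soliton_0 : S 0 = sqrt (2 / l).
Proof. by rewrite /S /soliton cosh_0 Rdiv_1_r. Qed.

(* The energy a'^2 - a^2 + l a^4 / 2 is constant, hence zero. *)
Lemma homoclinic a a2 : has_d2 a a2 -> (forall x, a2 x = a x - l * a x ^ 3) ->
  (forall x, a (- x) = a x) -> is_lim a p_infty 0 ->
  (forall x, a x = 0) \/ (forall x, a x = S x) \/ (forall x, a x = - S x).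
Proof.
move=> [a1 [H1 H2]] Ea ev lim_a.
have a10 := even_derive_0 _ _ H1 ev.
have lim_a2 : is_lim a2 p_infty 0.
  apply: (is_lim_ext (fun x => a x + - l * (a x * (a x * a x)))) => [x|].
    by rewrite Ea; ring.
  by apply: lim0_plus => //; apply: lim0_scal; do !apply: lim0_mult.
have lim_a1 := lim0_derive _ _ _ H1 H2 lim_a lim_a2.
pose En x := a1 x * a1 x + -1 * (a x * a x) + l / 2 * (a x * a x * (a x * a x)).
have dEn x : is_derive En x 0.
  evar_last.
    apply: is_derive_plus; first apply: is_derive_plus.
    - by apply: is_derive_mult; [exact: H2|exact: H2|exact: Rmult_comm].
    - by apply: is_derive_scal; apply: is_derive_mult; [exact: H1|exact: H1|exact: Rmult_comm].
    apply: is_derive_scal; apply: is_derive_mult; last exact: Rmult_comm.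
    - by apply: is_derive_mult; [exact: H1|exact: H1|exact: Rmult_comm].
    - by apply: is_derive_mult; [exact: H1|exact: H1|exact: Rmult_comm].
  rewrite /plus /mult /= Ea; match goal with |- @eq _ ?x ?y => change (@eq R x y) end; field.
have En0 x : En x = 0.
  rewrite -(lim0_const_eq0 En (En x)) => [//|y|]; first exact: derive_0_const.
  apply: lim0_plus; first apply: lim0_plus.
  - exact: lim0_mult.
  - by apply: lim0_scal; apply: lim0_mult.
  by apply: lim0_scal; do 2 apply: lim0_mult => //.
(* Zero energy reads a^2 (2 - l a^2) = 2 a'^2 >= 0. The bound is needed to apply Gronwall to the
   difference of two solutions. *)
have a_bound x : a x ^ 2 <= 2 / l.
  have h := En0 x; rewrite /En in h.
  have l2 : l * (2 / l) = 2 by field; lra.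
  have h1 : a x ^ 2 * (2 - l * a x ^ 2) = 2 * a1 x ^ 2 by nra.
  apply: Rnot_lt_le => lt_a; have := Rmult_lt_compat_l _ _ _ l_gt0 lt_a.
  have a2_gt0 : 0 < a x ^ 2 by apply: Rlt_trans lt_a; apply: Rdiv_lt_0_compat; lra.
  by have := pow2_ge_0 (a1 x); nra.
(* The difference of two solutions of the cubic equation solves a linear one with coefficient 1 - l
   (a^2 + a s + s^2). With l a^2 and l s^2 at most 2 it lies in [-5, 1], so 7 is a generous
   bound. *)
have unique s s1 : (forall x, is_derive s x (s1 x)) ->
    (forall x, is_derive s1 x (s x - l * s x ^ 3)) ->
    (forall x, s x ^ 2 <= 2 / l) -> s1 0 = 0 -> s 0 = a 0 -> forall x, a x = s x.
  move=> Hs1 Hs2 s_bound s10 sa0 x; apply: Rminus_diag_uniq.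
  apply: (linear_ode_unique (fun x => a x - s x) (fun x => a1 x - s1 x)
            (fun x => 1 - l * (a x ^ 2 + a x * s x + s x ^ 2)) 7) => [y|y|y||].
  - by apply: is_derive_minus.
  - evar_last; first by apply: is_derive_minus.
    by rewrite Ea /minus /plus /opp /=; Rring.
  - have := a_bound y; have := s_bound y => h1 h2.
    have l2 : l * (2 / l) = 2 by field; lra.
    have h3 : l * a y ^ 2 <= 2 by nra.
    have h4 : l * s y ^ 2 <= 2 by nra.
    have h5 : 0 <= l * (a y - s y) ^ 2 by apply: Rmult_le_pos; [lra | exact: pow2_ge_0].
    have h6 : 0 <= l * (a y + s y) ^ 2 by apply: Rmult_le_pos; [lra | exact: pow2_ge_0].
    apply: Rabs_le; split; lra.
  - by rewrite sa0; Rring.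
  - by rewrite a10 s10; Rring.
have S10 : - (S 0 * T 0) = 0 by rewrite /T sinh_0; lra.
(* As a'(0) = 0, zero energy at the origin leaves only a(0) = 0 or a(0)^2 = 2 / l, and the initial
   value determines the solution. *)
have h := En0 0; rewrite /En a10 in h.
have [a0|a0] := Req_dec (a 0) 0.
  left; apply: (unique (fun _ => 0) (fun _ => 0)) => // x.
  - exact: is_derive_const.
  - by evar_last; [exact: is_derive_const | rewrite /zero /=; Rring].
  by rewrite /= Rmult_0_l; apply: Rlt_le; apply: Rdiv_lt_0_compat; lra.
right; have h2 : a 0 ^ 2 = sqrt (2 / l) ^ 2.
  rewrite amplitude_sqr; apply: (Rmult_eq_reg_l (l * a 0 ^ 2 )); last first.
    by apply: Rmult_integral_contrapositive; split; [lra | exact: pow_nonzero].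
  field_simplify; [nra | lra].
have {h2} : (a 0 - sqrt (2 / l)) * (a 0 + sqrt (2 / l)) = 0 by lra.
case/Rmult_integral => h2; [left | right].
- apply: (unique S _ is_derive_soliton is_derive_soliton_tanh soliton_sqr_le S10).
  by rewrite soliton_0; lra.
- apply: (unique (fun x => - S x) (fun x => - - (S x * T x))) => [x|x|x||].
  + exact: is_derive_opp (is_derive_soliton x).
  + by evar_last; [exact: is_derive_opp (is_derive_soliton_tanh x) | rewrite /opp /=; Rring].
  + by have := soliton_sqr_le x; rewrite /=; lra.
  + by rewrite S10; Rring.
  + by rewrite soliton_0; lra.
Qed.

(* The Wronskian of b and S' is constant, hence zero. *)
Lemma linearized_soliton b b2 : has_d2 b b2 ->
  (forall x, b2 x = b x - 3 * l * S x ^ 2 * b x) ->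
  (forall x, b (- x) = b x) -> is_lim b p_infty 0 -> forall x, b x = 0.
Proof.
move=> [b1 [H1 H2]] Eb ev lim_b.
have b10 := even_derive_0 _ _ H1 ev.
have c_bound x : Rabs (1 - 3 * l * S x ^ 2) <= 7.
  have := soliton_sqr_le x; have := pow2_ge_0 (S x) => h1 h2.
  have l2 : l * (2 / l) = 2 by field; lra.
  have h3 : l * S x ^ 2 <= 2 by nra.
  apply: Rabs_le; split; nra.
have lim_b2 : is_lim b2 p_infty 0.
  apply: (is_lim_ext (fun x => (1 - 3 * l * S x ^ 2) * b x)) => [x|]; first by rewrite Eb; Rring.
  by apply: (lim0_mult_bounded _ _ 0 7) => // x _.
have lim_b1 := lim0_derive _ _ _ H1 H2 lim_b lim_b2.
have lim_S1 : is_lim (fun x => - (S x * T x)) p_infty 0.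
  apply: (is_lim_ext (fun x => - T x * S x)) => [x|]; first by rewrite /=; Rring.
  apply: (lim0_mult_bounded _ _ 0 1) => [|x _]; first exact: soliton_lim0.
  by rewrite Rabs_Ropp; apply: tanh_bound.
have lim_S2 : is_lim (fun x => S x - l * S x ^ 3) p_infty 0.
  apply: (is_lim_ext (fun x => S x + - l * (S x * (S x * S x)))) => [x|]; first by Rring.
  apply: lim0_plus; first exact: soliton_lim0.
  have lim_S := soliton_lim0.
  exact (lim0_scal _ _ (lim0_mult _ _ (lim0_mult _ _ lim_S lim_S) lim_S)).
pose W x := (S x - l * S x ^ 3) * b x + - (b1 x * - (S x * T x)).
have dW x : is_derive W x 0.
  have dS3 : is_derive (fun x => S x - l * S x ^ 3) x ((1 - 3 * l * S x ^ 2) * - (S x * T x)).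
    evar_last.
      apply: is_derive_minus; first exact: is_derive_soliton.
      by apply: is_derive_scal; apply: is_derive_pow; exact: is_derive_soliton.
    by rewrite /minus /plus /opp /=; Rring.
  evar_last.
    apply: is_derive_plus; last apply: is_derive_opp.
    - by apply: is_derive_mult; [exact: dS3|exact: H1|exact: Rmult_comm].
    - by apply: is_derive_mult; [exact: H2|exact: is_derive_soliton_tanh|exact: Rmult_comm].
  by rewrite /plus /mult /opp /= Eb; Rring.
have W0 : W 0 = 0.
  apply: (lim0_const_eq0 W) => [y|]; first exact: derive_0_const.
  apply: lim0_plus; first exact: lim0_mult.
  apply: (is_lim_ext (fun x => - b1 x * - (S x * T x))) => [x|]; first by Rring.
  apply: lim0_mult => //.
  by apply: (is_lim_ext (fun x => -1 * b1 x)) => [x|]; [Rring | exact: lim0_scal].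
(* At the origin b' = 0 and the Wronskian reduces to S''(0) b(0), where S''(0) = -S(0) is
   nonzero. *)
have b0 : b 0 = 0.
  move: W0; rewrite /W b10 soliton_0.
  have -> : sqrt (2 / l) - l * sqrt (2 / l) ^ 3 = - sqrt (2 / l).
    have -> : sqrt (2 / l) ^ 3 = sqrt (2 / l) ^ 2 * sqrt (2 / l) by Rring.
    by rewrite amplitude_sqr; field; lra.
  by have := amplitude_gt0; nra.
apply: (linear_ode_unique b b1 (fun x => 1 - 3 * l * S x ^ 2) 7) => // x.
by evar_last; [exact: H2 | rewrite Eb; Rring].
Qed.
End Soliton.

(** The counterpart of [linearized_soliton] for the zero profile. The conserved quantity is b'^2 -
    b^2; it vanishes at infinity, and b'(0) = 0 then forces b(0) = 0. *)
Lemma linearized_zero (b b2 : R -> R) : has_d2 b b2 -> (forall x, b2 x = b x) ->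
  (forall x, b (- x)%R = b x) -> is_lim b p_infty 0%R -> forall x, b x = 0%R.
Proof.
Local Open Scope R_scope.
move=> [b1 [H1 H2]] Eb ev lim_b.
have b10 := even_derive_0 _ _ H1 ev.
have lim_b2 : is_lim b2 p_infty 0 by apply: (is_lim_ext b).
have lim_b1 := lim0_derive _ _ _ H1 H2 lim_b lim_b2.
pose En x := b1 x * b1 x + -1 * (b x * b x).
have dEn x : is_derive En x 0.
  evar_last.
    apply: is_derive_plus.
    - by apply: is_derive_mult; [exact: H2|exact: H2|exact: Rmult_comm].
    - by apply: is_derive_scal; apply: is_derive_mult; [exact: H1|exact: H1|exact: Rmult_comm].
  by rewrite /plus /mult /= Eb; Rring.
have En0 : En 0 = 0.
  apply: (lim0_const_eq0 En) => [y|]; first exact: derive_0_const.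
  by apply: lim0_plus; [exact: lim0_mult | apply: lim0_scal; exact: lim0_mult].
apply: (linear_ode_unique b b1 (fun=> 1) 1) => // [x|x|].
- by evar_last; [exact: H2 | rewrite Eb; Rring].
- by rewrite Rabs_R1; lra.
by move: En0; rewrite /En b10; nra.
Qed.

Notation dtau f tau xi := (Derive_n (fun t => f t xi) 2 tau).
Notation dxi f tau xi := (Derive_n (fun x => f tau x) 2 xi).

(** * The equation order by order, and uniqueness *)

Section Equation.
Local Open Scope R_scope.
Variable gm : nat -> R.

Definition nonlinear_coeff (a : nat -> R) (k : nat) : R :=
  sum_n_m (fun m => gm m * PS_pow a m k) 2 k.

Lemma equation_coeff_SS v k tau xi :
  equation_coeff gm v k.+2 tau xi =
  dtau (v k.+2) tau xi + v k.+2 tau xi - (dtau (v k) tau xi + dxi (v k) tau xi)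
  + nonlinear_coeff (fun j => v j tau xi) k.+2.
Proof. by []. Qed.

Lemma equation_coeff_lt2 v k tau xi : (k < 2)%nat ->
  equation_coeff gm v k tau xi = dtau (v k) tau xi + v k tau xi.
Proof.
move=> k2; rewrite /equation_coeff PS_incr_n_simplify sum_n_m_zero; last lia.
case: Compare_dec.le_lt_dec => [h|_]; first lia.
rewrite /zero /=; ring.
Qed.

(** As m >= 2 and there is no constant term, order k of v^m does not see v_k: each order is a forced
    harmonic oscillator for v_k. *)
Lemma nonlinear_coeff_ext a a' k : a 0%nat = 0 -> (forall j, (j < k)%nat -> a' j = a j) ->
  nonlinear_coeff a' k = nonlinear_coeff a k.
Proof.
move=> a0 agree; have [k2|k2] := ltnP k 2.
  by rewrite /nonlinear_coeff !sum_n_m_zero //; lia.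
have [H _ _ _] := PS_pow_perturb a a' k a0 k2 agree.
apply: sum_n_m_ext_loc => m [m2 _]; rewrite H //; lia.
Qed.

(** A change beginning at order k enters v^m from order m + k - 1 on, so only g_2 acts at order k +
    1 and only g_2, g_3 at order k + 2. The extra term for k = 2 comes from the square of the
    change. *)
Lemma nonlinear_coeff_perturb a a' k : a 0%nat = 0 -> (1 < k)%nat ->
  (forall j, (j < k)%nat -> a' j = a j) ->
  nonlinear_coeff a' k.+1 = nonlinear_coeff a k.+1 + gm 2%nat * (2 * a 1%nat * (a' k - a k)) /\
  nonlinear_coeff a' k.+2 = nonlinear_coeff a k.+2
    + gm 2%nat * (2 * a 1%nat * (a' k.+1 - a k.+1)
        + (a' k - a k) * (2 * a 2%nat + (if k == 2%nat then a' k - a k else 0)))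
    + gm 3%nat * (3 * a 1%nat ^ 2 * (a' k - a k)).
Proof.
move=> a0 k2 agree.
have [H H21 H22 H3] := PS_pow_perturb a a' k a0 k2 agree.
have E m n : (m >= 2)%coq_nat -> (n.+1 < m + k)%nat -> (n <= k.+2)%nat ->
  sum_n_m (fun m => gm m * PS_pow a' m n) m n = sum_n_m (fun m => gm m * PS_pow a m n) m n.
  move=> m2 lt_n le_n; apply: sum_n_m_ext_loc => i [mi _]; rewrite H //; lia.
rewrite /nonlinear_coeff; split.
  rewrite !(sum_Sn_m _ 2 k.+1); try lia.
  rewrite E; try lia.
  rewrite H21 /plus /=; ring.
rewrite !(sum_Sn_m _ 2 k.+2); try lia.
rewrite !(sum_Sn_m _ 3 k.+2); try lia.
rewrite E; try lia.
rewrite H22 H3; move: (sum_n_m _ _ _) (PS_pow a 2 k.+2) (PS_pow a 3 k.+2) => s p q.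
rewrite /plus /=; Rring.
Qed.

Lemma nonlinear_coeff_2 a : a 0%nat = 0 -> nonlinear_coeff a 2 = gm 2%nat * a 1%nat ^ 2.
Proof.
by move=> a0; rewrite /nonlinear_coeff sum_n_n /= /PS_mult /= a0; ring.
Qed.

Lemma nonlinear_coeff_3 a : a 0%nat = 0 ->
  nonlinear_coeff a 3 = gm 2%nat * (2 * a 1%nat * a 2%nat) + gm 3%nat * a 1%nat ^ 3.
Proof.
move=> a0; rewrite /nonlinear_coeff sum_n_Sm; last lia.
by rewrite sum_n_n /plus /= /PS_mult /= a0; ring.
Qed.

Lemma smooth_d2_tau f xi : smooth f -> has_d2 (fun t => f t xi) (fun t => dtau f t xi).
Proof.
move=> sf; exists (fun t => Derive (fun s => f s xi) t); split=> t.
  by apply: Derive_correct; have [_ [h _]] := sf 1%nat t xi.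
by apply: Derive_correct; have [_ [_ [_ [[_ [h _]] _]]]] := sf 2%nat t xi.
Qed.

Lemma smooth_d2_xi f tau : smooth f -> has_d2 (fun x => f tau x) (fun x => dxi f tau x).
Proof.
move=> sf; exists (fun t => Derive (fun s => f tau s) t); split=> t.
  by apply: Derive_correct; have [_ [_ [h _]]] := sf 1%nat tau t.
by apply: Derive_correct; have [_ [_ [_ [_ [_ [_ [h _]]]]]]] := sf 2%nat tau t.
Qed.

Lemma has_d2_cos_sqr c : has_d2 (fun t => c * (2 / 3 - cos t ^ 2 / 3))
  (fun t => c * cos t ^ 2 - c * (2 / 3 - cos t ^ 2 / 3)).
Proof.
exists (fun t => c * (2 * cos t * sin t / 3)); split=> t; auto_derive => //; first by field.
have sin2 : sin t ^ 2 = 1 - cos t ^ 2 by have := sin2_cos2 t; rewrite /Rsqr; lra.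
by field [sin2].
Qed.

(* c (2/3 - cos^2/3) solves u'' + u = c cos^2. *)
Lemma forced_cos_sqr u u2 c : has_d2 u u2 -> (forall t, u2 t + u t = c * cos t ^ 2) ->
  (forall t, u (- t) = u t) ->
  forall t, u t = (u 0 - c / 3) * cos t + c * (2 / 3 - cos t ^ 2 / 3).
Proof.
move=> H E ev t.
have h := harmonic_even _ _ (has_d2_minus _ _ _ _ H (has_d2_cos_sqr c)).
have {h} := h _ _ t; rewrite cos_0 => h.
rewrite (_ : u 0 - c / 3 = u 0 - c * (2 / 3 - 1 ^ 2 / 3)); last by field.
rewrite -h; first by ring.
- by move=> s; have := E s; lra.
- by move=> s; rewrite ev cos_neg.
Qed.

Variable v : fseries.
Hypothesis v_sol : formal_solution gm v.
Hypothesis v_per : periodic_decaying v.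
Hypothesis v_even : even_even v.

(** Orders 1 and 2 are oscillators whose even solutions are known up to the amplitudes [a] and [a2]
    of cos; periodicity of v_3 gives the equation for [a]. *)
Lemma first_orders :
  exists a a2 : R -> R, [/\ forall tau xi, v 1%nat tau xi = a xi * cos tau,
    forall tau xi, v 2%nat tau xi =
      a2 xi * cos tau - gm 2%nat * a xi ^ 2 * (2 / 3 - cos tau ^ 2 / 3),
    exists d, has_d2 a d /\ (forall xi, d xi = a xi - lambda gm * a xi ^ 3),
    forall xi, a (- xi) = a xi & is_lim a p_infty 0].
Proof.
have [v0 [sm E]] := v_sol.
have v0' : v 0%nat = (fun _ _ => 0).
  by do 2 apply: functional_extensionality => ?.
pose a xi := v 1%nat 0 xi.
have Ea tau xi : v 1%nat tau xi = a xi * cos tau.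
  apply: (harmonic_even (fun t => v 1%nat t xi) _ (smooth_d2_tau _ xi (sm 1%nat))) => t.
    by have := E 1%nat t xi; rewrite equation_coeff_lt2 //; lra.
  by have [] := v_even 1%nat t xi.
pose a2 xi := v 2%nat 0 xi - - (gm 2%nat * a xi ^ 2) / 3.
have Ea2 xi tau : v 2%nat tau xi =
    a2 xi * cos tau + - (gm 2%nat * a xi ^ 2) * (2 / 3 - cos tau ^ 2 / 3).
  apply: (forced_cos_sqr (fun t => v 2%nat t xi) _ _ (smooth_d2_tau _ xi (sm 2%nat))) => t.
    have := E 2%nat t xi; rewrite equation_coeff_SS nonlinear_coeff_2 // v0' Ea.
    rewrite !(Derive_n_const 1); lra.
  by have [] := v_even 2%nat t xi.
exists a, a2; split=> //.
- by move=> tau xi; rewrite Ea2; ring.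
- exists (fun x => dxi (v 1%nat) 0 x); split; first exact: smooth_d2_xi.
  move=> xi; set d := dxi _ _ _.
  have dtau1 tau : dtau (v 1%nat) tau xi = - (a xi * cos tau).
    by have := E 1%nat tau xi; rewrite equation_coeff_lt2 // -Ea; lra.
  have dxi1 tau : dxi (v 1%nat) tau xi = d * cos tau.
    rewrite (has_d2_Derive_n _ (fun x => cos tau * dxi (v 1%nat) 0 x)); first by rewrite /d; ring.
    apply: has_d2_eq; first by apply: (has_d2_scal (cos tau)); exact: (smooth_d2_xi _ 0 (sm 1%nat)).
    - by move=> x; rewrite [RHS]Ea; rewrite /a; ring.
    - by [].
  (* Expanding -2 g_2 v_1 v_2 gives 4/3 g_2^2 a^3 cos and -2/3 g_2^2 a^3 cos^3. The unknown [a2]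
     multiplies cos^2 only and drops out of the resonance condition. *)
  have := resonance _ _ 0 (d - a xi + 4 / 3 * gm 2%nat ^ 2 * a xi ^ 3)
    (- 2 * gm 2%nat * a xi * a2 xi) (- 2 / 3 * gm 2%nat ^ 2 * a xi ^ 3 - gm 3%nat * a xi ^ 3)
    (smooth_d2_tau _ xi (sm 3%nat)).
  rewrite /lambda => h.
  suff : d - a xi + 4 / 3 * gm 2%nat ^ 2 * a xi ^ 3 +
    3 / 4 * (- 2 / 3 * gm 2%nat ^ 2 * a xi ^ 3 - gm 3%nat * a xi ^ 3) = 0 by lra.
  apply: h => t; last by have [] := v_per 3%nat; move=> h _; apply: h.
  have := E 3%nat t xi; rewrite equation_coeff_SS nonlinear_coeff_3 //.
  rewrite dtau1 dxi1 Ea2 Ea; lra.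
- by move=> xi; have [_] := v_even 1%nat 0 xi.
by have [_ h] := v_per 1%nat; have [] := h 0.
Qed.

(** Nondegeneracy of the linearized equation is a hypothesis, so that one induction covers both the
    zero series and the soliton series, whose linearizations have different conserved quantities. *)
Lemma solution_unique (u : fseries) :
  formal_solution gm u -> periodic_decaying u -> even_even u ->
  (forall tau xi, u 1%nat tau xi = v 1%nat tau xi) ->
  (forall b b2, has_d2 b b2 ->
     (forall xi, b2 xi = b xi - 3 * lambda gm * v 1%nat 0 xi ^ 2 * b xi) ->
     (forall xi, b (- xi) = b xi) -> is_lim b p_infty 0 -> forall xi, b xi = 0) ->
  u = v.
Proof.
move=> [u0 [su Eu]] u_per u_even uv1 lin.
have [v0 [sv Ev]] := v_sol.
have [a [a2 [Ea Ea2 _ _ _]]] := first_orders.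
apply: functional_extensionality => k.
elim/ltn_ind: k => k IH.
have [k_lt2|k2] := ltnP k 2.
  case: k IH k_lt2 => [|[|//]] _ _; do 2 apply: functional_extensionality => ?.
    by rewrite u0 v0.
  exact: uv1.
have agree tau xi j : (j < k)%nat -> u j tau xi = v j tau xi by move=> /IH->.
pose b xi := u k 0 xi - v k 0 xi.
have [K EK] : exists K, k = K.+2 by exists (k - 2)%nat; lia.
have Eb tau xi : u k tau xi - v k tau xi = b xi * cos tau.
  have h := harmonic_even _ _ (has_d2_minus _ _ _ _
    (smooth_d2_tau _ xi (su k)) (smooth_d2_tau _ xi (sv k))).
  rewrite (h _ _ tau) // => t; last by have [-> _] := u_even k t xi; have [-> _] := v_even k t xi.
  have := Eu k t xi; have := Ev k t xi; rewrite EK !equation_coeff_SS -EK.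
  rewrite (IH K); last by rewrite EK; lia.
  have := nonlinear_coeff_ext (fun j => v j t xi) (fun j => u j t xi) k (v0 t xi) (agree t xi).
  lra.
pose b2 xi := dxi (u k) 0 xi - dxi (v k) 0 xi.
have Hb : has_d2 b b2 by apply: has_d2_minus; apply: smooth_d2_xi.
have dxi_w tau xi : dxi (u k) tau xi - dxi (v k) tau xi = b2 xi * cos tau.
  have h1 := has_d2_minus _ _ _ _ (smooth_d2_xi _ tau (su k)) (smooth_d2_xi _ tau (sv k)).
  have h2 := has_d2_scal (cos tau) _ _ Hb.
  have e := has_d2_unique _ _ _ xi (has_d2_eq _ _ _ _ h1 (fun x => Eb tau x) (fun=> erefl)).
  rewrite (e (fun x => b2 x * cos tau)) //.
  by apply: (has_d2_eq _ _ _ _ h2) => x; ring.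
have dtau_w tau xi : dtau (u k) tau xi - dtau (v k) tau xi = - (b xi * cos tau).
  have := Eu k tau xi; have := Ev k tau xi; rewrite EK !equation_coeff_SS -EK.
  rewrite (IH K); last by rewrite EK; lia.
  have := nonlinear_coeff_ext (fun j => v j tau xi) (fun j => u j tau xi)
    k (v0 tau xi) (agree tau xi).
  have := Eb tau xi; lra.
(* At order k + 1 the difference is driven by -2 g_2 a b cos^2; its own first harmonic, of amplitude
   [c], stays undetermined. *)
have [c Ec] : exists c : R -> R, forall xi tau, u k.+1 tau xi - v k.+1 tau xi =
    c xi * cos tau + (- 2 * gm 2%nat * a xi * b xi) * (2 / 3 - cos tau ^ 2 / 3).
  eexists => xi; apply: forced_cos_sqr.
  - exact: (has_d2_minus _ _ _ _ (smooth_d2_tau _ xi (su k.+1)) (smooth_d2_tau _ xi (sv k.+1))).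
  - move=> t; have := Eu k.+1 t xi; have := Ev k.+1 t xi; rewrite EK !equation_coeff_SS -EK.
    rewrite (IH K.+1); last by rewrite EK; lia.
    have [-> _] := nonlinear_coeff_perturb (fun j => v j t xi) (fun j => u j t xi)
      k (v0 t xi) k2 (agree t xi).
    rewrite Eb Ea; lra.
  - by move=> t; have [-> _] := u_even k.+1 t xi; have [-> _] := v_even k.+1 t xi.
suff b0 xi : b xi = 0.
  by do 2 apply: functional_extensionality => ?; apply: Rminus_diag_uniq; rewrite Eb b0; ring.
apply: (lin b b2 Hb) xi => [xi|xi|].
- have Ea0 : v 1%nat 0 xi = a xi by rewrite Ea cos_0; ring.
  (* For k = 2 the square of the difference contributes at order 4, but only to cos^2, hence not to
     the resonance. *)
  rewrite Ea0; pose d := if k == 2%nat then b xi else 0.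
  (* The two g_2 products add up to -6 g_2^2 a^2 b cos (2/3 - cos^2/3), whence 4 and -2 after the
     change of sign. Then 4 - (3/4) 2 = 5/2 and (3/4) 3 = 9/4 are three times the coefficients in
     lambda. *)
  have := resonance _ _ 0 (b2 xi - b xi + 4 * gm 2%nat ^ 2 * a xi ^ 2 * b xi)
    (- gm 2%nat * (2 * a xi * c xi + b xi * (2 * a2 xi + d)))
    (- 2 * gm 2%nat ^ 2 * a xi ^ 2 * b xi - 3 * gm 3%nat * a xi ^ 2 * b xi)
    (has_d2_minus _ _ _ _ (smooth_d2_tau _ xi (su k.+2)) (smooth_d2_tau _ xi (sv k.+2))).
  rewrite /lambda => h.
  suff : b2 xi - b xi + 4 * gm 2%nat ^ 2 * a xi ^ 2 * b xi +
    3 / 4 * (- 2 * gm 2%nat ^ 2 * a xi ^ 2 * b xi - 3 * gm 3%nat * a xi ^ 2 * b xi) = 0 by lra.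
  apply: h => t; last by have [-> _] := u_per k.+2; have [-> _] := v_per k.+2.
  have := Eu k.+2 t xi; have := Ev k.+2 t xi; rewrite !equation_coeff_SS.
  have [_ ->] := nonlinear_coeff_perturb (fun j => v j t xi) (fun j => u j t xi)
      k (v0 t xi) k2 (agree t xi).
  have -> : (if k == 2%nat then u k t xi - v k t xi else 0) = d * cos t.
    by rewrite /d; case: ifP => _; [exact: Eb | ring].
  rewrite Ec Eb Ea Ea2; have := dxi_w t xi; have := dtau_w t xi; lra.
- by rewrite /b; have [_ ->] := u_even k 0 xi; have [_ ->] := v_even k 0 xi.
have [_ /(_ 0) [hu _]] := u_per k; have [_ /(_ 0) [hv _]] := v_per k.
apply: (is_lim_ext (fun x => u k 0 x + -1 * v k 0 x)) => [x|]; first by rewrite /b; ring.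
by apply: lim0_plus => //; apply: lim0_scal.
Qed.
End Equation.

(** * The span of the functions S^i cos(q tau) and the operators acting on it *)

Section TrigPolynomials.
Local Open Scope R_scope.
Variable l : R.
Hypothesis l_gt0 : 0 < l.
Let S := soliton l.
Let T x := sinh x / cosh x.

(** The predicate [B] on exponent and harmonic carries all bookkeeping (degree, parity, excluded
    monomials), so that each operation only has to say how it moves index pairs. *)
Inductive trig_poly (B : nat -> nat -> Prop) : (R -> R -> R) -> Prop :=
| tp_zero : trig_poly B (fun _ _ => 0)
| tp_mono c i q : B i q -> trig_poly B (fun tau xi => c * (S xi ^ i * cos (INR q * tau)))
| tp_add f g : trig_poly B f -> trig_poly B g -> trig_poly B (fun tau xi => f tau xi + g tau xi).

Lemma tp_empty B f tau xi : (forall i q, ~ B i q) -> trig_poly B f -> f tau xi = 0.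
Proof.
by move=> B0; elim=> [//|c i q /B0 //|g h _ -> _ ->]; ring.
Qed.

Lemma tp_ext B f g : trig_poly B f -> (forall tau xi, f tau xi = g tau xi) -> trig_poly B g.
Proof.
move=> Hf fg; suff <- : f = g by [].
by do 2 apply: functional_extensionality => ?.
Qed.

Lemma tp_scal B c f : trig_poly B f -> trig_poly B (fun tau xi => c * f tau xi).
Proof.
elim=> [|d i q Biq|f1 f2 _ IH1 _ IH2].
- by apply: tp_ext (tp_zero B) _ => tau xi; ring.
- by apply: tp_ext (tp_mono B (c * d) i q Biq) _ => tau xi; ring.
by apply: tp_ext (tp_add B _ _ IH1 IH2) _ => tau xi; ring.
Qed.

Lemma tp_sub B f g : trig_poly B f -> trig_poly B g ->
  trig_poly B (fun tau xi => f tau xi - g tau xi).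
Proof.
by move=> Hf Hg; apply: tp_ext (tp_add B _ _ Hf (tp_scal B (-1) _ Hg)) _ => tau xi; ring.
Qed.

Lemma tp_weaken (B B' : nat -> nat -> Prop) f : (forall i q, B i q -> B' i q) ->
  trig_poly B f -> trig_poly B' f.
Proof.
move=> BB'; elim=> [|d i q /BB' Biq|f1 f2 _ IH1 _ IH2].
- exact: tp_zero.
- exact: tp_mono.
exact: tp_add.
Qed.

(** With truncated subtraction, (p - q) + (q - p) is the absolute difference of p and q. *)
Lemma cos_mult p q tau : cos (INR p * tau) * cos (INR q * tau) =
  1 / 2 * cos (INR (p + q) * tau) + 1 / 2 * cos (INR ((p - q) + (q - p)) * tau).
Proof.
wlog le_pq : p q / (p <= q)%nat => [H|].
  have [/H//|/ltnW/H E] := leqP p q.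
  by rewrite Rmult_comm E (addnC q p) (addnC (q - p)%nat).
have -> : ((p - q) + (q - p) = q - p)%nat by lia.
rewrite [in INR (q - p)](_ : (q - p)%nat = (q - p)%coq_nat) // minus_INR; last lia.
rewrite (_ : (p + q)%nat = (p + q)%coq_nat) // plus_INR.
rewrite Rmult_plus_distr_r Rmult_minus_distr_r cos_plus cos_minus; field.
Qed.

Lemma tp_mul (B1 B2 B3 : nat -> nat -> Prop) f g :
  (forall i q i' q', B1 i q -> B2 i' q' ->
     B3 (i + i')%nat (q + q')%nat /\ B3 (i + i')%nat ((q - q') + (q' - q))%nat) ->
  trig_poly B1 f -> trig_poly B2 g -> trig_poly B3 (fun tau xi => f tau xi * g tau xi).
Proof.
move=> BB Hf Hg; elim: Hf => [|c i q Biq|f1 f2 _ IH1 _ IH2].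
- by apply: tp_ext (tp_zero B3) _ => tau xi; ring.
- elim: Hg => [|d i' q' Biq'|g1 g2 _ IH1 _ IH2].
  + by apply: tp_ext (tp_zero B3) _ => tau xi; ring.
  + have [H1 H2] := BB _ _ _ _ Biq Biq'.
    apply: tp_ext (tp_add _ _ _ (tp_mono B3 (c * d / 2) _ _ H1) (tp_mono B3 (c * d / 2) _ _ H2)) _.
    move=> tau xi; rewrite -(_ : (i + i')%coq_nat = (i + i')%nat) // pow_add.
    transitivity (c * d * (S xi ^ i * S xi ^ i') * (cos (INR q * tau) * cos (INR q' * tau))).
      by rewrite cos_mult; field.
    ring.
  by apply: tp_ext (tp_add _ _ _ IH1 IH2) _ => tau xi; ring.
by apply: tp_ext (tp_add _ _ _ IH1 IH2) _ => tau xi; ring.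
Qed.

Lemma tp_sum_f_R0 B (F : nat -> R -> R -> R) n :
  (forall i, (i <= n)%nat -> trig_poly B (F i)) ->
  trig_poly B (fun tau xi => sum_f_R0 (fun i => F i tau xi) n).
Proof.
elim: n => [|n IH] H /=; first exact: H.
by apply: tp_add; [apply: IH => i le_in; apply: H; lia | exact: H].
Qed.

Lemma tp_sum_n_m B (F : nat -> R -> R -> R) m n :
  (forall i, (m <= i <= n)%nat -> trig_poly B (F i)) ->
  trig_poly B (fun tau xi => sum_n_m (fun i => F i tau xi) m n).
Proof.
elim: n => [|n IH] H.
  case: m H => [|m] H.
    by apply: tp_ext (H 0%nat _) _ => // tau xi; rewrite sum_n_n.
  by apply: tp_ext (tp_zero B) _ => tau xi; rewrite sum_n_m_zero //; lia.
have [le_mn|lt_nm] := leqP m n.+1.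
  apply: tp_ext (tp_add B _ _ (IH _) (H n.+1 _)) _; try lia.
    by move=> i ?; apply: H; lia.
  by move=> tau xi; rewrite [RHS]sum_n_Sm //; lia.
by apply: tp_ext (tp_zero B) _ => tau xi; rewrite sum_n_m_zero //; lia.
Qed.

(* Closed under both partial derivatives, hence contained in the smooth functions. *)
Inductive elementary : (R -> R -> R) -> Prop :=
| el_const c : elementary (fun _ _ => c)
| el_soliton : elementary (fun _ xi => S xi)
| el_tanh : elementary (fun _ xi => T xi)
| el_cos c : elementary (fun tau _ => cos (c * tau))
| el_sin c : elementary (fun tau _ => sin (c * tau))
| el_add f g : elementary f -> elementary g -> elementary (fun tau xi => f tau xi + g tau xi)
| el_mul f g : elementary f -> elementary g -> elementary (fun tau xi => f tau xi * g tau xi).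

Lemma elementary_derive f : elementary f -> exists ft fx,
  [/\ elementary ft, elementary fx,
      forall tau xi : R, is_derive (fun t => f t xi) tau (ft tau xi) &
      forall tau xi : R, is_derive (fun x => f tau x) xi (fx tau xi)].
Proof.
have el0 := el_const 0.
elim=> [c|||c|c|g h Hg [gt [gx [Hgt Hgx Dgt Dgx]]] Hh [ht [hx [Hht Hhx Dht Dhx]]]
  |g h Hg [gt [gx [Hgt Hgx Dgt Dgx]]] Hh [ht [hx [Hht Hhx Dht Dhx]]]].
- by exists (fun _ _ => 0), (fun _ _ => 0); split=> // *; apply: is_derive_const.
- exists (fun _ _ => 0), (fun _ xi => -1 * (S xi * T xi)); split=> //.
  + exact: el_mul (el_const (-1)) (el_mul _ _ el_soliton el_tanh).
  + by move=> *; apply: is_derive_const.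
  + by move=> _ xi; evar_last; [exact: is_derive_soliton | rewrite /T /S; Rring].
- exists (fun _ _ => 0), (fun _ xi => 1 + -1 * (T xi * T xi)); split=> //.
  + exact: el_add (el_const 1) (el_mul _ _ (el_const (-1)) (el_mul _ _ el_tanh el_tanh)).
  + by move=> *; apply: is_derive_const.
  + by move=> _ xi; evar_last; [exact: is_derive_tanh | rewrite /T; Rring].
- exists (fun tau _ => - c * sin (c * tau)), (fun _ _ => 0); split=> //.
  + exact: el_mul (el_const (- c)) (el_sin c).
  + by move=> tau xi; auto_derive => //; Rring.
  + by move=> *; apply: is_derive_const.
- exists (fun tau _ => c * cos (c * tau)), (fun _ _ => 0); split=> //.
  + exact: el_mul (el_const c) (el_cos c).
  + by move=> tau xi; auto_derive => //; Rring.
  + by move=> *; apply: is_derive_const.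
- exists (fun tau xi => gt tau xi + ht tau xi), (fun tau xi => gx tau xi + hx tau xi).
  by split; [exact: el_add | exact: el_add | |] => tau xi; apply: is_derive_plus.
exists (fun tau xi => gt tau xi * h tau xi + g tau xi * ht tau xi),
  (fun tau xi => gx tau xi * h tau xi + g tau xi * hx tau xi).
split; first by apply: el_add; apply: el_mul.
- by apply: el_add; apply: el_mul.
- by move=> tau xi; apply: is_derive_mult => //; exact: Rmult_comm.
by move=> tau xi; apply: is_derive_mult => //; exact: Rmult_comm.
Qed.

Lemma elementary_continuous f tau xi : elementary f -> continuity_2d_pt f tau xi.
Proof.
have cont (g : R -> R) (dg : R -> R) : (forall x, is_derive g x (dg x)) ->
    forall x, continuity_pt g x.
  by move=> H x; apply/continuity_pt_filterlim/ex_derive_continuous; exists (dg x).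
elim=> [c|||c|c|g h _ Hg _ Hh|g h _ Hg _ Hh].
- exact: continuity_2d_pt_const.
- apply: (continuity_1d_2d_pt_comp S (fun _ x => x)); last exact: continuity_2d_pt_id2.
  exact: (cont S (fun x => - (S x * T x)) (is_derive_soliton l)).
- apply: (continuity_1d_2d_pt_comp T (fun _ x => x)); last exact: continuity_2d_pt_id2.
  exact: (cont T (fun x => 1 - T x ^ 2) is_derive_tanh).
- apply: (continuity_1d_2d_pt_comp (fun t => cos (c * t)) (fun t _ => t));
    last exact: continuity_2d_pt_id1.
  by apply: (cont _ (fun t => - c * sin (c * t))) => t; auto_derive => //; Rring.
- apply: (continuity_1d_2d_pt_comp (fun t => sin (c * t)) (fun t _ => t));
    last exact: continuity_2d_pt_id1.
  by apply: (cont _ (fun t => c * cos (c * t))) => t; auto_derive => //; Rring.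
- exact: continuity_2d_pt_plus.
exact: continuity_2d_pt_mult.
Qed.

Lemma elementary_smooth f : elementary f -> smooth f.
Proof.
move=> Hf n; elim: n f Hf => [|n IH] f Hf x y.
  by split=> //; apply: elementary_continuous.
have [ft [fx [Hft Hfx Dft Dfx]]] := elementary_derive f Hf.
split; first exact: elementary_continuous.
split; first by exists (ft x y).
split; first by exists (fx x y).
have -> : (fun u v => Derive (fun z => f z v) u) = ft.
  by do 2 apply: functional_extensionality => ?; apply: is_derive_unique.
have -> : (fun u v => Derive (fun z => f u z) v) = fx.
  by do 2 apply: functional_extensionality => ?; apply: is_derive_unique.
by split; apply: IH.
Qed.

Lemma tp_smooth B f : trig_poly B f -> smooth f.
Proof.
move=> Hf; apply: elementary_smooth; elim: Hf => [|c i q _|g h _ Hg _ Hh].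
- exact: el_const.
- apply: el_mul (el_const c) (el_mul _ _ _ (el_cos _)).
  by elim: i => [|i IH] /=; [exact: el_const | exact: el_mul el_soliton IH].
exact: el_add.
Qed.

Lemma dtau_add f g tau xi : smooth f -> smooth g ->
  dtau (fun t x => f t x + g t x) tau xi = dtau f tau xi + dtau g tau xi.
Proof.
move=> sf sg; exact: (has_d2_Derive_n _ _ _ (has_d2_plus _ _ _ _
  (smooth_d2_tau f xi sf) (smooth_d2_tau g xi sg))).
Qed.

Lemma dxi_add f g tau xi : smooth f -> smooth g ->
  dxi (fun t x => f t x + g t x) tau xi = dxi f tau xi + dxi g tau xi.
Proof.
move=> sf sg; exact: (has_d2_Derive_n _ _ _ (has_d2_plus _ _ _ _
  (smooth_d2_xi f tau sf) (smooth_d2_xi g tau sg))).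
Qed.

Lemma dtau_mono c i q tau xi :
  dtau (fun t x => c * (S x ^ i * cos (INR q * t))) tau xi =
  - INR q ^ 2 * (c * (S xi ^ i * cos (INR q * tau))).
Proof.
apply: (has_d2_Derive_n _ (fun t => - INR q ^ 2 * (c * (S xi ^ i * cos (INR q * t))))).
exists (fun t => - INR q * (c * (S xi ^ i * sin (INR q * t)))).
by split=> t; auto_derive => //; Rring.
Qed.

Lemma has_d2_soliton_pow i : has_d2 (fun x => S x ^ i)
  (fun x => INR i ^ 2 * S x ^ i - l / 2 * INR i * (INR i + 1) * S x ^ i.+2).
Proof.
exists (fun x => INR i * S x ^ i * - T x); split=> x.
  evar_last; first exact: is_derive_pow (is_derive_soliton l x).
  case: i => [|i]; first by rewrite /=; Rring.
  by rewrite -pred_Sn /T /S -tech_pow_Rmult; Rring.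
evar_last.
  apply: is_derive_mult; last exact: Rmult_comm.
    by apply: is_derive_scal; exact: is_derive_pow (is_derive_soliton l x).
  exact: is_derive_opp (is_derive_tanh x).
rewrite /plus /mult /opp /= -/S -/(T x).
have e := soliton_tanh l l_gt0 x.
(* For i = 0 the exponent [i.-1] is 0 rather than -1; the factor [INR i] makes the identity hold
   there too. *)
have e2 : INR i * S x ^ i.-1 * S x = INR i * S x ^ i.
  by case: (i) => [|j]; [rewrite /=; ring | rewrite -pred_Sn /=; ring].
transitivity (INR i * (INR i * S x ^ i.-1 * S x) * T x ^ 2 - INR i * S x ^ i * (1 - T x ^ 2)).
  by Rring.
by rewrite e2 /T e -/S -!tech_pow_Rmult; field.
Qed.

Lemma dxi_mono c i q tau xi :
  dxi (fun t x => c * (S x ^ i * cos (INR q * t))) tau xi =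
  INR i ^ 2 * c * (S xi ^ i * cos (INR q * tau))
  - l / 2 * INR i * (INR i + 1) * c * (S xi ^ i.+2 * cos (INR q * tau)).
Proof.
have h := has_d2_scal (c * cos (INR q * tau)) _ _ (has_d2_soliton_pow i).
transitivity (c * cos (INR q * tau) *
  (INR i ^ 2 * S xi ^ i - l / 2 * INR i * (INR i + 1) * S xi ^ i.+2)).
  apply: (has_d2_Derive_n _ _ _ (has_d2_eq _ _ _ _ h _ (fun=> erefl))) => x; ring.
rewrite /=; ring.
Qed.

(** The harmonic q is multiplied by 1 - q^2, which removes q = 1. *)
Lemma tp_oscillator (B B' : nat -> nat -> Prop) f :
  (forall i q, B i q -> q <> 1%nat -> B' i q) -> trig_poly B f ->
  trig_poly B' (fun tau xi => dtau f tau xi + f tau xi).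
Proof.
move=> BB'; elim=> [|c i q Biq|g h Hg IHg Hh IHh].
- by apply: tp_ext (tp_zero B') _ => tau xi; rewrite (Derive_n_const 1); ring.
- have [->|/eqP q1] := eqVneq q 1%nat.
    by apply: tp_ext (tp_zero B') _ => tau xi; rewrite dtau_mono /=; ring.
  apply: tp_ext (tp_mono B' ((1 - INR q ^ 2) * c) _ _ (BB' i q Biq q1)) _ => tau xi.
  rewrite dtau_mono; ring.
apply: tp_ext (tp_add _ _ _ IHg IHh) _ => tau xi.
rewrite dtau_add; [ring | exact: tp_smooth Hg | exact: tp_smooth Hh].
Qed.

(** The coefficient of S^i cos(q tau) is multiplied by i^2 - q^2, so for i = q only the term in
    S^(i+2) survives; in particular S cos(tau) yields a multiple of S^3 cos(tau). *)
Lemma tp_laplacian (B B' : nat -> nat -> Prop) f :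
  (forall i q, B i q -> i <> q -> B' i q) -> (forall i q, B i q -> B' i.+2 q) ->
  trig_poly B f -> trig_poly B' (fun tau xi => dtau f tau xi + dxi f tau xi).
Proof.
move=> BB1 BB2; elim=> [|c i q Biq|g h Hg IHg Hh IHh].
- by apply: tp_ext (tp_zero B') _ => tau xi; rewrite !(Derive_n_const 1); ring.
- have H := tp_mono B' (- (l / 2 * INR i * (INR i + 1) * c)) _ _ (BB2 i q Biq).
  have [iq|/eqP iq] := eqVneq i q.
    by apply: tp_ext H _ => tau xi; rewrite dtau_mono dxi_mono iq; ring.
  apply: tp_ext (tp_add _ _ _ H (tp_mono B' ((INR i ^ 2 - INR q ^ 2) * c) _ _ (BB1 i q Biq iq))) _.
  by move=> tau xi; rewrite dtau_mono dxi_mono; ring.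
apply: tp_ext (tp_add _ _ _ IHg IHh) _ => tau xi.
have sg := tp_smooth _ _ Hg; have sh := tp_smooth _ _ Hh.
rewrite dtau_add // dxi_add //; ring.
Qed.

(* Only the first harmonic is not in the range of the oscillator. *)
Lemma tp_oscillator_solve (B B' H : nat -> nat -> Prop) f :
  (forall i q, B i q -> B' i q) -> (forall i, B i 1%nat -> H i 0%nat) -> trig_poly B f ->
  exists y b, [/\ trig_poly B' y, trig_poly H b &
    forall tau xi, f tau xi = dtau y tau xi + y tau xi + b tau xi * cos tau].
Proof.
move=> BB' BH; elim=> [|c i q Biq|f1 f2 _ [y1 [b1 [Hy1 Hb1 E1]]] _ [y2 [b2 [Hy2 Hb2 E2]]]].
- exists (fun _ _ => 0), (fun _ _ => 0); split; try exact: tp_zero.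
  by move=> tau xi; rewrite (Derive_n_const 1); ring.
- have [q1|q1] := eqVneq q 1%nat.
    rewrite q1 in Biq *; exists (fun _ _ => 0), (fun tau xi => c * (S xi ^ i * cos (INR 0 * tau))).
    split; [exact: tp_zero | apply: tp_mono; exact: BH |] => tau xi.
    by rewrite (Derive_n_const 1) /= Rmult_0_l cos_0 Rmult_1_l; ring.
  have q2 : 1 - INR q ^ 2 <> 0.
    case: q Biq q1 => [|[|q]] // _ _; first by rewrite /=; lra.
    rewrite !S_INR; have := pos_INR q; nra.
  exists (fun tau xi => c / (1 - INR q ^ 2) * (S xi ^ i * cos (INR q * tau))), (fun _ _ => 0).
  split; [by apply: tp_mono; apply: BB' | exact: tp_zero |] => tau xi.
  by rewrite dtau_mono; field.
exists (fun tau xi => y1 tau xi + y2 tau xi), (fun tau xi => b1 tau xi + b2 tau xi).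
split; [exact: tp_add | exact: tp_add |] => tau xi.
rewrite E1 E2 dtau_add; [ring | exact: tp_smooth Hy1 | exact: tp_smooth Hy2].
Qed.

Lemma tp_dtau_homogeneous (B : nat -> nat -> Prop) q f tau xi :
  (forall i q', B i q' -> q' = q) -> trig_poly B f -> dtau f tau xi = - INR q ^ 2 * f tau xi.
Proof.
move=> Bq; elim=> [|c i q' /Bq ->|g h Hg IHg Hh IHh].
- by rewrite (Derive_n_const 1); ring.
- exact: dtau_mono.
rewrite dtau_add ?IHg ?IHh; [ring | exact: tp_smooth Hg | exact: tp_smooth Hh].
Qed.

Lemma tp_mul_mono (B B' : nat -> nat -> Prop) c a q f :
  (forall i q', B i q' -> q' = 0%nat /\ B' (i + a)%nat q) -> trig_poly B f ->
  trig_poly B' (fun tau xi => c * (S xi ^ a * cos (INR q * tau)) * f tau xi).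
Proof.
move=> BB'; elim=> [|d i q' /BB' [-> Biq]|g h Hg IHg Hh IHh].
- by apply: tp_ext (tp_zero B') _ => tau xi; ring.
- apply: tp_ext (tp_mono B' (c * d) _ _ Biq) _ => tau xi.
  rewrite -(_ : (i + a)%coq_nat = (i + a)%nat) // pow_add /= Rmult_0_l cos_0; ring.
by apply: tp_ext (tp_add _ _ _ IHg IHh) _ => tau xi; ring.
Qed.

(** The linearization of a'' - a + l a^3 at S, and equally at -S. *)
Definition linearized (p : R -> R -> R) (tau xi : R) : R :=
  dxi p tau xi - p tau xi + 3 * l * S xi ^ 2 * p tau xi.

Definition odd_upto (n i q : nat) : Prop := [/\ q = 0%nat, odd i & (i <= n)%nat].

Lemma linearized_scal c p tau xi : smooth p ->
  linearized (fun t x => c * p t x) tau xi = c * linearized p tau xi.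
Proof.
move=> sp; rewrite /linearized.
rewrite (has_d2_Derive_n _ _ _ (has_d2_scal c _ _ (smooth_d2_xi p tau sp))); ring.
Qed.

Lemma linearized_add p r tau xi : smooth p -> smooth r ->
  linearized (fun t x => p t x + r t x) tau xi = linearized p tau xi + linearized r tau xi.
Proof. by move=> sp sr; rewrite /linearized dxi_add //; ring. Qed.

(* The operator maps S^j to a combination of S^j and S^(j+2), where the
   coefficient l (3 - j (j+1) / 2) of S^(j+2) vanishes only for j = 2 and that
   of S^j vanishes for j = 1. *)
Lemma linearized_solve_pow m : exists p, trig_poly (odd_upto m.*2.+1) p /\
  forall tau xi, linearized p tau xi = S xi ^ m.*2.+3.
Proof.
elim: m => [|m [p [Hp Ep]]].
  exists (fun tau xi => / (2 * l) * (S xi ^ 1 * cos (INR 0 * tau))); split.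
    by apply: tp_mono; split.
  by move=> tau xi; rewrite /linearized dxi_mono /= Rmult_0_l cos_0; field; lra.
(* S^j is mapped to (j^2 - 1) S^j + kappa S^(j+2). As j >= 3, kappa <= -3 l is nonzero, and the term
   in S^j is removed with the preimage of S^j from the induction hypothesis. *)
pose j := m.*2.+3; pose kappa := l * (3 - INR j * (INR j + 1) / 2).
have j3 : 3 <= INR j by rewrite /j !S_INR; have := pos_INR m.*2; lra.
have kappa0 : kappa <> 0.
  by apply: Rmult_integral_contrapositive; split; [lra | nra].
pose r tau xi := 1 * (S xi ^ j * cos (INR 0 * tau)).
have Hr : trig_poly (odd_upto m.+1.*2.+1) r.
  by apply: tp_mono; split; rewrite /j //= ?odd_double //; lia.
have {}Hp : trig_poly (odd_upto m.+1.*2.+1) p.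
  by apply: tp_weaken Hp => i q [-> ? ?]; split=> //; lia.
have Hs := tp_add _ _ _ Hr (tp_scal _ (- (INR j ^ 2 - 1)) _ Hp).
exists (fun tau xi => / kappa * (r tau xi + - (INR j ^ 2 - 1) * p tau xi)); split.
  exact: tp_scal.
move=> tau xi; rewrite linearized_scal; last exact: tp_smooth Hs.
rewrite linearized_add; [|exact: tp_smooth Hr| exact: tp_smooth (tp_scal _ _ _ Hp)].
rewrite linearized_scal; last exact: tp_smooth Hp.
rewrite Ep /linearized /r dxi_mono -/j.
rewrite -[m.+1.*2.+3]/j.+2 [INR 0]/= Rmult_0_l cos_0 -!tech_pow_Rmult.
move: kappa0; rewrite /kappa; move=> k0; field; split; [|lra].
by move=> h; apply: k0; rewrite -[RHS](Rmult_0_r (l / 2)) -h; field.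
Qed.

(** The preimage loses two degrees, exactly the lag between a correction and the order that calls
    for it. Carrying [odd n] in the predicate makes the preimage vanish for even n. *)
Lemma linearized_solve n b :
  trig_poly (fun i q => [/\ q = 0%nat, odd i, odd n & (3 <= i <= n)%nat]) b ->
  exists p, trig_poly (fun i q => [/\ q = 0%nat, odd i, odd n & (i.+2 <= n)%nat]) p /\
  forall tau xi, linearized p tau xi = b tau xi.
Proof.
elim=> [|c i q [-> oi on /andP [i3 le_in]]|b1 b2 _ [p1 [Hp1 E1]] _ [p2 [Hp2 E2]]].
- exists (fun _ _ => 0); split; first exact: tp_zero.
  by move=> tau xi; rewrite /linearized (Derive_n_const 1); ring.
- have [p [Hp Ep]] := linearized_solve_pow (i - 3)./2.
  have ei : i = (i - 3)./2.*2.+3 by move: (odd_double_half (i - 3)); rewrite oddB // oi /=; lia.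
  exists (fun tau xi => c * p tau xi); split.
    by apply: tp_weaken (tp_scal _ c _ Hp) => j q' [-> oj le_j]; split=> //; lia.
  move=> tau xi; rewrite linearized_scal; last exact: tp_smooth Hp.
  by rewrite Ep -ei /= Rmult_0_l cos_0; ring.
exists (fun tau xi => p1 tau xi + p2 tau xi); split; first exact: tp_add.
move=> tau xi; rewrite linearized_add ?E1 ?E2 //; [exact: tp_smooth Hp1 | exact: tp_smooth Hp2].
Qed.

End TrigPolynomials.

(** * Construction of approximate solutions with leading amplitude S or -S *)

Section Existence.
Local Open Scope R_scope.
Variables (gm : nat -> R) (sg : R).
Hypothesis sg_sqr : sg ^ 2 = 1.
Hypothesis lambda_gt0 : 0 < lambda gm.
Let l := lambda gm.
Let S := soliton l.

(* Monomials S^i cos(q tau) of weight n with i >= m; for m = 1 these are the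
   terms allowed in v_n. *)
Definition weighted (m n i q : nat) : Prop :=
  [/\ (m <= i <= n)%nat, (q <= n)%nat, odd i = odd n & odd q = odd n].

Lemma odd_dist p q : odd ((p - q) + (q - p)) = odd p (+) odd q.
Proof.
have [le_pq|/ltnW le_qp] := leqP p q.
  by rewrite (eqP le_pq) add0n oddB // addbC.
by rewrite (eqP le_qp) addn0 oddB.
Qed.

Lemma tp_PS_pow v m n : (forall j, trig_poly l (weighted 1 j) (v j)) ->
  trig_poly l (weighted m n) (fun tau xi => PS_pow (fun j => v j tau xi) m n).
Proof.
move=> Hv; elim: m n => [|m IH] n.
  case: n => [|n] /=; last exact: tp_zero.
  apply: (tp_ext l _ _ _ (tp_mono l (weighted 0 0) 1 0 0 _)) => [//|tau xi].
  by rewrite /= Rmult_0_l cos_0; ring.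
apply: tp_sum_f_R0 => i le_in.
apply: (tp_mul l (weighted 1 i) (weighted m (n - i)) _ _ _ _ (Hv i) (IH _)).
move=> i1 q1 i2 q2 [Hi1 Hq1 e1 e2] [Hi2 Hq2 e3 e4].
have odd_n : odd i (+) odd (n - i) = odd n by rewrite -oddD subnKC.
have odd_i : odd (i1 + i2) = odd n by rewrite oddD e1 e3.
split; split=> //; try (clear -le_in Hi1 Hq1 Hi2 Hq2; lia).
  by rewrite oddD e2 e4.
by rewrite odd_dist e2 e4.
Qed.

(** S cos(tau) is excluded because the linearized operator has only S^3, S^5, ... in its range on
    odd powers of S. *)
Definition nonresonant (n i q : nat) : Prop := weighted 1 n i q /\ ~ (i = 1%nat /\ q = 1%nat).

(** Each part avoids S cos(tau) for its own reason: the oscillator removes q = 1, the Laplacian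
    removes i = q, and the powers v^m have i >= m >= 2. *)
Lemma tp_equation_coeff v n : (forall j, trig_poly l (weighted 1 j) (v j)) ->
  trig_poly l (nonresonant n.+2) (equation_coeff gm v n.+2).
Proof.
move=> Hv.
apply: (tp_ext l _ (fun tau xi => (dtau (v n.+2) tau xi + v n.+2 tau xi)
  + -1 * (dtau (v n) tau xi + dxi (v n) tau xi)
  + sum_n_m (fun m => gm m * PS_pow (fun j => v j tau xi) m n.+2) 2 n.+2)); last first.
  by move=> tau xi; rewrite equation_coeff_SS /nonlinear_coeff; ring.
apply: tp_add; first apply: tp_add.
- apply: (tp_oscillator l (weighted 1 n.+2)) (Hv _) => i q Biq q1.
  by split=> // -[].
- apply: tp_scal; apply: (tp_laplacian l lambda_gt0 (weighted 1 n)) (Hv _) => i q [? ? ? ?].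
  + by move=> iq; split; [split; lia | lia].
  + by split; [split; lia | lia].
apply: tp_sum_n_m => m Hm; apply: tp_scal.
apply: (tp_weaken l (weighted m n.+2)) (tp_PS_pow v m n.+2 Hv) => i q [? ? ? ?].
by split; [split; lia | lia].
Qed.

Definition upd (v : fseries) (k : nat) (f : R -> R -> R) : fseries :=
  fun j => if j == k then f else v j.

(** The shapes of v_1 and v_2 are recorded because a correction at a later order interacts, in the
    next two equations, only with them. *)
Record approximation (k : nat) (v : fseries) : Prop := Approximation {
  approx_0 : v 0%nat = (fun _ _ => 0);
  approx_1 : forall tau xi, v 1%nat tau xi = sg * S xi * cos tau;
  approx_2 : forall tau xi, v 2%nat tau xi =
    - gm 2%nat * (sg * S xi) ^ 2 * (2 / 3 - cos tau ^ 2 / 3);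
  approx_tp : forall j, trig_poly l (weighted 1 j) (v j);
  approx_eq : forall j tau xi, (j <= k.+1)%nat -> equation_coeff gm v j tau xi = 0;
  (* E_(k+2) is nonresonant, so that v_(k+2) can be corrected to cancel it *)
  approx_next : exists y, trig_poly l (weighted 1 k.+2) y /\
    forall tau xi, equation_coeff gm v k.+2 tau xi = dtau y tau xi + y tau xi
}.

Lemma equation_coeff_top u v k tau xi : v 0%nat tau xi = 0 ->
  (forall j, (j < k)%nat -> u j = v j) ->
  equation_coeff gm u k tau xi = equation_coeff gm v k tau xi
    + (dtau (u k) tau xi + u k tau xi) - (dtau (v k) tau xi + v k tau xi).
Proof.
move=> v0 agree; case: k agree => [|[|k]] agree; try by rewrite !equation_coeff_lt2 //; ring.
rewrite !equation_coeff_SS (agree k); last lia.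
rewrite (nonlinear_coeff_ext gm (fun j => v j tau xi) (fun j => u j tau xi)) //; first by ring.
by move=> j lt_j; rewrite agree.
Qed.

Lemma equation_coeff_agree u v k tau xi : v 0%nat tau xi = 0 ->
  (forall j, (j <= k)%nat -> u j = v j) ->
  equation_coeff gm u k tau xi = equation_coeff gm v k tau xi.
Proof.
move=> v0 agree; rewrite (equation_coeff_top u v) // => [|j /ltnW]; last exact: agree.
by rewrite agree //; ring.
Qed.

Lemma cos_2a_sqr x : cos (2 * x) = 2 * cos x ^ 2 - 1.
Proof. by rewrite cos_2a_cos; ring. Qed.

Lemma cos_3a x : cos (3 * x) = 4 * cos x ^ 3 - 3 * cos x.
Proof.
have -> : 3 * x = 2 * x + x by ring.
rewrite cos_plus sin_2a cos_2a_sqr; have := sin2_cos2 x; rewrite /Rsqr => h.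
have -> : 2 * sin x * cos x * sin x = 2 * (sin x * sin x) * cos x by ring.
have -> : sin x * sin x = 1 - cos x * cos x by lra.
ring.
Qed.

Lemma approximation_init : exists v, approximation 1 v.
Proof.
pose v : fseries := fun j => match j with
  | 1%nat => fun tau xi => sg * (S xi ^ 1 * cos (INR 1 * tau))
  (* In harmonics, 2/3 - cos^2/3 is 1/2 - cos(2 tau)/6. *)
  | 2%nat => fun tau xi => - gm 2%nat * sg ^ 2 / 2 * (S xi ^ 2 * cos (INR 0 * tau))
               + gm 2%nat * sg ^ 2 / 6 * (S xi ^ 2 * cos (INR 2 * tau))
  | _ => fun _ _ => 0 end.
have e1 tau xi : v 1%nat tau xi = sg * S xi * cos tau by rewrite /v /= !Rmult_1_l; ring.
have e2 tau xi : v 2%nat tau xi = - gm 2%nat * (sg * S xi) ^ 2 * (2 / 3 - cos tau ^ 2 / 3).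
  rewrite /v [INR 0]/= [INR 2]/= Rmult_0_l cos_0 cos_2a_sqr; field.
have d1 tau xi : dtau (v 1%nat) tau xi = - (sg * S xi * cos tau).
  by rewrite /v dtau_mono -/S [INR 1]/= Rmult_1_l; ring.
have d2 tau xi : dtau (v 2%nat) tau xi =
    - gm 2%nat * sg ^ 2 * 2 / 3 * S xi ^ 2 * (2 * cos tau ^ 2 - 1).
  have sm c q : (q <= 2)%nat -> ~~ odd q ->
      smooth (fun tau xi => c * (S xi ^ 2 * cos (INR q * tau))).
    by move=> q2 oq; apply: (tp_smooth l (weighted 1 2)); apply: tp_mono; split=> //; exact/negbTE.
  rewrite (dtau_add _ _ _ _ (sm (- gm 2%nat * sg ^ 2 / 2) 0%nat isT isT)
    (sm (gm 2%nat * sg ^ 2 / 6) 2%nat isT isT)).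
  rewrite !dtau_mono -/S [INR 0]/= [INR 2]/= Rmult_0_l cos_0 cos_2a_sqr; field.
have Hv j : trig_poly l (weighted 1 j) (v j).
  case: j => [|[|[|j]]]; try exact: tp_zero; first exact: tp_mono.
  by apply: tp_add; apply: tp_mono.
exists v; apply: Approximation => //.
- case=> [|[|[|//]]] tau xi _.
  + by rewrite equation_coeff_lt2 // /v (Derive_n_const 1); ring.
  + by rewrite equation_coeff_lt2 // d1 e1; ring.
  rewrite equation_coeff_SS nonlinear_coeff_2 // !(Derive_n_const 1).
  rewrite d2 e2 e1 /v; field.
(* With v_3 = 0, the first harmonic at order 3 cancels by the profile equation; [kappa] S^3 cos(3
   tau) remains, and the oscillator multiplies cos(3 tau) by -8. *)
pose kappa := sg * (gm 2%nat ^ 2 / 6 + gm 3%nat / 4).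
exists (fun tau xi => - kappa / 8 * (S xi ^ 3 * cos (INR 3 * tau))).
split; first exact: tp_mono.
move=> tau xi; rewrite dtau_mono equation_coeff_SS nonlinear_coeff_3 // (Derive_n_const 1) d1.
rewrite [dxi (v 1%nat) tau xi]dxi_mono // e1 e2 (_ : INR 3 = 3); last by rewrite /=; ring.
have sg3 : sg ^ 3 = sg by rewrite -[RHS]Rmult_1_r -sg_sqr; ring.
rewrite cos_3a (_ : INR 1 = 1) // Rmult_1_l.
transitivity (sg * (lambda gm * S xi ^ 3 * cos tau) +
  sg ^ 3 * S xi ^ 3 * (gm 2%nat ^ 2 * (2 * cos tau ^ 3 / 3 - 4 * cos tau / 3)
  + gm 3%nat * cos tau ^ 3)); first by rewrite /S /l (_ : v 3%nat tau xi = 0) //; field.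
by rewrite sg3 -/S /kappa /lambda; field.
Qed.

(** Subtracting [y] makes order k + 2 exact. The first harmonic b cos(tau) at order k + 3 is then
    cancelled by [w] in v_(k+1), and [z] in v_(k+2) repairs order k + 2. *)
Lemma approximation_step k v : (0 < k)%nat -> approximation k v ->
  exists v', approximation k.+1 v' /\ forall j, (j <= k)%nat -> v' j = v j.
Proof.
move=> k_gt0 [v0 v1 v2 Hv Ev [y [Hy Ey]]].
pose u := upd v k.+2 (fun tau xi => v k.+2 tau xi - y tau xi).
have agree_u j : (j < k.+2)%nat -> u j = v j by rewrite /u /upd; case: eqP => // ->; lia.
have uk2 : u k.+2 = (fun tau xi => v k.+2 tau xi - y tau xi) by rewrite /u /upd eqxx.
have Hu j : trig_poly l (weighted 1 j) (u j).
  by rewrite /u /upd; case: eqP => [->|_]; [exact: tp_sub | exact: Hv].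
have su j : smooth (u j) by exact: tp_smooth (Hu j).
have u0 tau xi : u 0%nat tau xi = 0 by rewrite agree_u // v0.
have Eu j tau xi : (j <= k.+2)%nat -> equation_coeff gm u j tau xi = 0.
  rewrite leq_eqVlt => /orP[/eqP->|lt_j].
    rewrite (equation_coeff_top u v); [|by rewrite v0|exact: agree_u].
    rewrite Ey uk2.
    have -> : dtau (fun t x => v k.+2 t x - y t x) tau xi = dtau (v k.+2) tau xi - dtau y tau xi.
      exact: (has_d2_Derive_n _ _ _ (has_d2_minus _ _ _ _
        (smooth_d2_tau _ xi (tp_smooth l _ _ (Hv _))) (smooth_d2_tau _ xi (tp_smooth l _ _ Hy)))).
    by ring.
  rewrite (equation_coeff_agree u v) ?v0 ?Ev //.
  by move=> i le_i; apply: agree_u; lia.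
have [y2 [b [Hy2 Hb E3]]] := tp_oscillator_solve l (nonresonant k.+3) (weighted 1 k.+3)
  (fun i q => [/\ q = 0%nat, odd i, odd k.+3 & (3 <= i <= k.+3)%nat]) _
  (fun i q H => proj1 H) ltac:(idtac; move=> i [[/andP[h1 h2] h3 h4 h5] h6];
     split=> //; [by rewrite h4 -h5 | lia]) (tp_equation_coeff u k.+1 Hu).
have [p [Hp Ep]] := linearized_solve l lambda_gt0 _ _ Hb.
have sp := tp_smooth _ _ _ Hp.
pose w tau xi := 1 * (S xi ^ 0 * cos (INR 1 * tau)) * p tau xi.
pose c := - gm 2%nat * sg.
(* The correction [w] adds 2 g_2 v_1 w at order k + 2, so [z] must solve z'' + z = 2 c S p cos^2;
   hence z = c S p (1 - cos(2 tau)/3). *)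
pose z tau xi := c * (S xi ^ 1 * cos (INR 0 * tau)) * p tau xi
  + - c / 3 * (S xi ^ 1 * cos (INR 2 * tau)) * p tau xi.
(* The cos^3 terms caused by [w] and [z] at order k + 3 total (2 g_2^2 + 3 g_3) S^2 p; a quarter of
   this is the third harmonic, which [y3] absorbs. *)
pose kappa := (2 * gm 2%nat ^ 2 + 3 * gm 3%nat) / 4.
pose y3 tau xi := - kappa / 8 * (S xi ^ 2 * cos (INR 3 * tau)) * p tau xi.
have Hw : trig_poly l (weighted 1 k.+1) w.
  by apply: tp_mul_mono Hp => i q [-> oi ok le_i]; split=> //; split; move: oi ok => /=; lia.
have Hz1 : trig_poly l (weighted 1 k.+2)
    (fun tau xi => c * (S xi ^ 1 * cos (INR 0 * tau)) * p tau xi).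
  by apply: tp_mul_mono Hp => i q [-> oi ok le_i]; split=> //; split; move: oi ok => /=; lia.
have Hz2 : trig_poly l (weighted 1 k.+2)
    (fun tau xi => - c / 3 * (S xi ^ 1 * cos (INR 2 * tau)) * p tau xi).
  by apply: tp_mul_mono Hp => i q [-> oi ok le_i]; split=> //; split; move: oi ok => /=; lia.
have Hz : trig_poly l (weighted 1 k.+2) z by exact: tp_add.
have Hy3 : trig_poly l (weighted 1 k.+3) y3.
  by apply: tp_mul_mono Hp => i q [-> oi ok le_i]; split=> //; split; move: oi ok => /=; lia.
have homog d a q tau xi : dtau (fun t x => d * (S x ^ a * cos (INR q * t)) * p t x) tau xi =
    - INR q ^ 2 * (d * (S xi ^ a * cos (INR q * tau)) * p tau xi).
  have H : trig_poly l (fun _ q' => q' = q)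
      (fun tau xi => d * (S xi ^ a * cos (INR q * tau)) * p tau xi).
    by apply: tp_mul_mono Hp => i q' [-> _ _ _].
  exact: (tp_dtau_homogeneous l _ _ _ tau xi (fun _ _ e => e) H).
have dtau_w tau xi : dtau w tau xi = - w tau xi by rewrite homog /w [INR 1]/=; ring.
have w_cos tau xi : w tau xi = cos tau * p tau xi by rewrite /w [INR 1]/= !Rmult_1_l /=; ring.
have dxi_w tau xi : dxi w tau xi = cos tau * dxi p tau xi.
  have h x : cos tau * p tau x = w tau x by rewrite w_cos.
  exact: (has_d2_Derive_n _ _ _ (has_d2_eq _ _ _ _
    (has_d2_scal (cos tau) _ _ (smooth_d2_xi _ tau sp)) h (fun=> erefl))).
have z_cos tau xi : z tau xi = c * S xi * p tau xi * (4 / 3 - 2 * cos tau ^ 2 / 3).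
  by rewrite /z [INR 0]/= [INR 2]/= Rmult_0_l cos_0 cos_2a_sqr; field.
have dtau_z tau xi : dtau z tau xi + z tau xi = 2 * c * S xi * p tau xi * cos tau ^ 2.
  rewrite (dtau_add _ _ _ _ (tp_smooth _ _ _ Hz1) (tp_smooth _ _ _ Hz2)) !homog z_cos.
  by rewrite [INR 0]/= [INR 2]/= Rmult_0_l cos_0 cos_2a_sqr; field.
pose v' := upd (upd u k.+1 (fun tau xi => u k.+1 tau xi + w tau xi)) k.+2
  (fun tau xi => u k.+2 tau xi + z tau xi).
have v'k1 : v' k.+1 = (fun tau xi => u k.+1 tau xi + w tau xi).
  by rewrite /v' /upd ifF ?eqxx //; apply/eqP; lia.
have v'k2 : v' k.+2 = (fun tau xi => u k.+2 tau xi + z tau xi) by rewrite /v' /upd eqxx.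
have v'j j : j <> k.+1 -> j <> k.+2 -> v' j = u j.
  by move=> j1 j2; rewrite /v' /upd; do 2 case: eqP => // _.
have agree_v' j : (j < k.+1)%nat -> v' j = u j by move=> lt_j; apply: v'j; lia.
(* For k = 1 the first harmonic is needed at order 4, which is even, so [p] vanishes: v_2 keeps its
   prescribed form and no quadratic self-interaction arises. *)
have p_small tau xi : k = 1%nat -> p tau xi = 0.
  by move=> k1; apply: tp_empty Hp => i q []; rewrite k1.
have Hv' j : trig_poly l (weighted 1 j) (v' j).
  have [->|/eqP j1] := eqVneq j k.+1; first by rewrite v'k1; apply: tp_add.
  have [->|/eqP j2] := eqVneq j k.+2; first by rewrite v'k2; apply: tp_add.
  by rewrite v'j.
have k1_gt1 : (1 < k.+1)%nat by lia.
have pert tau xi := nonlinear_coeff_perturb gm (fun j => u j tau xi) (fun j => v' j tau xi)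
  k.+1 (u0 tau xi) k1_gt1 (fun j lt_j => f_equal (fun f => f tau xi) (agree_v' j lt_j)).
have u1 tau xi : u 1%nat tau xi = sg * S xi * cos tau by rewrite agree_u ?v1.
have u2 tau xi : u 2%nat tau xi = - gm 2%nat * (sg * S xi) ^ 2 * (2 / 3 - cos tau ^ 2 / 3).
  by rewrite agree_u ?v2 //; lia.
have sw := tp_smooth _ _ _ Hw; have sz := tp_smooth _ _ _ Hz.
exists v'; split; last by move=> j le_j; rewrite agree_v' ?agree_u //; lia.
apply: Approximation => //.
- by rewrite agree_v' ?agree_u.
- move=> tau xi; have [k1|/eqP k1] := eqVneq k 1%nat.
    have := v'k1; rewrite k1 => ->; rewrite u2 w_cos p_small //; ring.
  by rewrite agree_v' ?u2 //; lia.
- move=> j tau xi; rewrite leq_eqVlt => /orP[/eqP->|].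
    rewrite equation_coeff_SS v'k2 dtau_add // agree_v' //.
    have := Eu k.+2 tau xi (leqnn _); rewrite equation_coeff_SS.
    have [-> _] := pert tau xi; rewrite v'k1 u1 w_cos.
    have := dtau_z tau xi; rewrite /c; nra.
  rewrite ltnS leq_eqVlt => /orP[/eqP->|lt_j].
    rewrite (equation_coeff_top v' u) // v'k1 dtau_add // Eu // dtau_w; ring.
  by rewrite (equation_coeff_agree v' u) ?Eu // => [|i le_i]; [lia | apply: agree_v'; lia].
exists (fun tau xi => y2 tau xi + y3 tau xi); split; first exact: tp_add.
move=> tau xi; rewrite (dtau_add _ _ _ _ (tp_smooth _ _ _ Hy2) (tp_smooth _ _ _ Hy3)).
have := E3 tau xi; rewrite !equation_coeff_SS.
have [_ ->] := pert tau xi.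
have -> : (if k.+1 == 2%nat then v' k.+1 tau xi - u k.+1 tau xi else 0) = 0.
  by case: eqP => // -[k1]; rewrite v'k1 w_cos p_small //; ring.
rewrite v'j; [|lia|lia]; rewrite v'k1 v'k2 (dtau_add _ _ _ _ (su _) sw) (dxi_add _ _ _ _ (su _) sw).
rewrite dtau_w dxi_w w_cos z_cos u1 u2 homog -Ep /linearized -/S.
rewrite /y3 /kappa (_ : INR 3 = 3) ?cos_3a; last by rewrite /=; ring.
have -> : l = 5 / 6 * gm 2%nat ^ 2 - 3 / 4 * gm 3%nat by [].
rewrite /c; move: (S xi) => s; rewrite !(Rpow_mult_distr sg) !Rpow_mult_distr sg_sqr => e.
have -> : forall V C P Q, 2 * (sg * s * C) * (V + - gm 2%nat * sg * s * P * Q - V) =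
    sg ^ 2 * (- 2 * gm 2%nat * s ^ 2 * C * P * Q) by move=> *; ring.
rewrite sg_sqr; lra.
Qed.
End Existence.

(** * The limiting series, its symmetries and its decay *)

Section Conclusion.
Local Open Scope R_scope.
Variable gm : nat -> R.
Hypothesis lambda_gt0 : 0 < lambda gm.
Let l := lambda gm.
Let S := soliton l.

(** Choice turns the step lemma into a chain of approximations; the coefficient of order j no longer
    changes from stage j on, so the diagonal inherits every equation. *)
Lemma solution_exists sg : sg ^ 2 = 1 -> exists v : fseries,
  [/\ formal_solution gm v, forall tau xi, v 1%nat tau xi = sg * S xi * cos tau &
      forall j, trig_poly l (weighted 1 j) (v j)].
Proof.
move=> sg2.
have step k (v : {v | approximation gm sg k.+1 v}) :
    {v' : {v' | approximation gm sg k.+2 v'} |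
     forall j, (j <= k.+1)%nat -> sval v' j = sval v j}.
  have /constructive_indefinite_description [v' [Hv' E]] :=
    approximation_step gm sg sg2 lambda_gt0 k.+1 (sval v) isT (svalP v).
  by exists (exist _ v' Hv').
have /constructive_indefinite_description v_init := approximation_init gm sg sg2 lambda_gt0.
pose st : forall k, {v | approximation gm sg k.+1 v} :=
  nat_rect _ v_init (fun k v => sval (step k v)).
have st_agree j m : (j <= m)%nat -> sval (st m) j = sval (st j) j.
  elim: m => [|m IH]; first by rewrite leqn0 => /eqP->.
  rewrite leq_eqVlt => /orP[/eqP->//|le_jm]; rewrite -IH //.
  by apply: (svalP (step m (st m))); lia.
pose v : fseries := fun j => sval (st j) j.
have Hv j : trig_poly l (weighted 1 j) (v j) := approx_tp _ _ _ _ (svalP (st j)) j.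
exists v; split=> // [|tau xi]; last exact: approx_1 (svalP (st 1%nat)) tau xi.
have v0 j tau xi : sval (st j) 0%nat tau xi = 0 by rewrite (approx_0 _ _ _ _ (svalP (st j))).
split; first exact: v0.
split=> [k|k tau xi]; first exact: tp_smooth (Hv k).
rewrite (equation_coeff_agree gm v (sval (st k))) //.
  by apply: approx_eq (svalP (st k)) _ _ _ _; lia.
by move=> j /st_agree.
Qed.

Lemma tp_even v : (forall j, trig_poly l (weighted 1 j) (v j)) -> even_even v.
Proof.
move=> Hv k tau xi; elim: (Hv k) => [//|c i q _|f g _ [-> ->] _ [-> ->] //].
by rewrite soliton_even Ropp_mult_distr_r_reverse cos_neg.
Qed.

Lemma soliton_pow_lim0 i x : x = p_infty \/ x = m_infty -> is_lim (fun xi => S xi ^ i.+1) x 0.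
Proof.
have lim_p : is_lim (fun xi => S xi ^ i.+1) p_infty 0.
  elim: i => [|i IH].
    by apply: (is_lim_ext S) => [xi|]; [rewrite pow_1 | exact: soliton_lim0].
  exact: (lim0_mult _ S IH (soliton_lim0 l lambda_gt0)).
case=> -> //; apply/is_lim_spec => eps.
have [M HM] := proj1 (lim0P _) lim_p eps (cond_pos eps).
exists (- M) => y lt_y; rewrite Rminus_0_r -[y]Ropp_involutive /S soliton_even.
by apply: HM; lra.
Qed.

Lemma tp_periodic_decaying v : (forall j, trig_poly l (weighted 1 j) (v j)) -> periodic_decaying v.
Proof.
move=> Hv k; elim: (Hv k) => [|c i q [/andP [i1 _] _ _ _]|f g _ [Pf Lf] _ [Pg Lg]].
- by split=> // tau; split; exact: is_lim_const.
(* Divisibility by S, that is i >= 1, is what gives decay. *)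
- rewrite -(prednK i1); move: i.-1 => {i1} j; split=> [tau xi|tau].
    have -> : INR q * (tau + 2 * PI) = INR q * tau + 2 * INR q * PI by ring.
    by rewrite cos_period.
  have H x : x = p_infty \/ x = m_infty ->
      is_lim (fun xi => c * (S xi ^ j.+1 * cos (INR q * tau))) x 0.
    move=> /(soliton_pow_lim0 j x) h.
    apply: (is_lim_ext (fun xi => c * cos (INR q * tau) * S xi ^ j.+1)) => [xi|]; first by ring.
    have := is_lim_scal_l _ (c * cos (INR q * tau)) x _ h.
    by rewrite /= Rmult_0_r.
  by split; apply: H; [left|right].
split=> [tau xi|tau]; first by rewrite Pf Pg.
have [f1 f2] := Lf tau; have [g1 g2] := Lg tau.
by split; rewrite -[0]Rplus_0_r; apply: is_lim_plus'.
Qed.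

End Conclusion.

(** * From the span to polynomial coefficients of the harmonics *)

Section Expansion.
Import GRing.Theory.
Local Open Scope ring_scope.

Lemma admissible_coeff0 k q : admissible_coeff k q 0.
Proof. by split=> [||i|]; rewrite ?size_poly0 ?coef0 ?eqxx ?dvdp0. Qed.

Lemma admissible_coeffD k q (p r : {poly R}) :
  admissible_coeff k q p -> admissible_coeff k q r -> admissible_coeff k q (p + r).
Proof.
move=> [s1 z1 p1 d1] [s2 z2 p2 d2]; split.
- by apply: leq_trans (size_polyD _ _) _; rewrite geq_max s1.
- by move=> o; rewrite z1 // z2 // addr0.
- by move=> i; rewrite coefD; have [->|/p1 //] := eqVneq p`_i 0; rewrite add0r => /p2.
exact: dvdp_add.
Qed.

Lemma admissible_coeff_mono k q c i : weighted 1 k i q -> admissible_coeff k q (c *: 'X^i).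
Proof.
move=> [/andP [i1 ik] qk pi pq]; split.
- by apply: leq_trans (size_scale_leq _ _) _; rewrite size_polyXn ltnS.
- by rewrite oddD pq addbb.
- by move=> j; rewrite coefZ coefXn; case: (eqVneq j i) => [->|_] //; rewrite mulr0 eqxx.
by rewrite -(prednK i1) exprSr scalerAl dvdp_mull.
Qed.

(** Monomials are collected by harmonic; the conditions in [weighted 1 k] are the degree bound, the
    parities and divisibility by S. *)
Lemma tp_expansion l k f : trig_poly l (weighted 1 k) f -> has_soliton_expansion l k f.
Proof.
elim=> [|c i q Biq|f1 f2 _ [a1 [A1 E1]] _ [a2 [A2 E2]]].
- exists (fun=> 0); split=> [q _|tau xi]; first exact: admissible_coeff0.
  rewrite sum_n_Reals sum_f_R0E big1 // => q _.
  by rewrite horner0 Rmult_0_l.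
- exists (fun q' => if q' == q then c *: 'X^i else 0); split=> [q' _|tau xi].
    case: eqP => [->|_]; [exact: admissible_coeff_mono | exact: admissible_coeff0].
  have [_ qk _ _] := Biq; rewrite -ltnS in qk.
  rewrite sum_n_Reals sum_f_R0E big_mkord (bigD1 (Ordinal qk)) //= eqxx big1.
    rewrite hornerZ hornerXn addr0 -RmultE -RpowE; ring.
  by move=> j; rewrite -val_eqE /= => /negbTE->; rewrite horner0 Rmult_0_l.
exists (fun q => a1 q + a2 q); split=> [q qk|tau xi].
  by apply: admissible_coeffD; [exact: A1 | exact: A2].
rewrite E1 E2 !sum_n_Reals -sum_plus; apply: sum_eq => q _.
by rewrite hornerD -RplusE; ring.
Qed.
End Expansion.

(** * Classification of the solutions *)

Section Main.
Local Open Scope R_scope.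
Variable gm : nat -> R.
Hypothesis lambda_gt0 : 0 < lambda gm.

Definition zero_series : fseries := fun _ _ _ => 0.

Lemma zero_series_solution : formal_solution gm zero_series.
Proof.
split=> //; split=> k.
  apply: (tp_smooth (lambda gm) (weighted 1 k)); exact: tp_zero.
move=> tau xi; have [k2|k2] := ltnP k 2.
  by rewrite equation_coeff_lt2 // (Derive_n_const 1) /zero_series; ring.
have -> : k = (k - 2).+2 by lia.
rewrite equation_coeff_SS !(Derive_n_const 1) /nonlinear_coeff.
rewrite (sum_n_m_ext_loc _ (fun=> 0)) => [|m [m2 _]].
  by rewrite sum_n_m_const_zero /zero_series /zero /=; ring.
case: m m2 => [|m] m2; first lia.
rewrite /= /PS_mult sum_eq_R0; first by ring.
by move=> i _; rewrite /zero_series; ring.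
Qed.

Lemma zero_series_decaying : periodic_decaying zero_series.
Proof. by move=> k; split=> // tau; split; exact: is_lim_const. Qed.

Lemma zero_series_even : even_even zero_series.
Proof. by []. Qed.

(** When the leading amplitude vanishes, the uniqueness induction is run against the zero series, so
    a nonzero solution cannot start at a later order. *)
Lemma solution_trichotomy v :
  formal_solution gm v -> periodic_decaying v -> even_even v ->
  let S := soliton (lambda gm) in
  [\/ v = zero_series, forall tau xi, v 1%nat tau xi = S xi * cos tau |
      forall tau xi, v 1%nat tau xi = - S xi * cos tau].
Proof.
move=> Hs Hp He S.
have [a [a2 [Ea _ [d [Hd Ed]] a_even a_lim]]] := first_orders gm v Hs Hp He.
have [a0|[aS|aS]] := homoclinic _ lambda_gt0 a d Hd Ed a_even a_lim.
- apply: Or31; apply: esym; apply: (solution_unique gm v Hs Hp He).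
  + exact: zero_series_solution.
  + exact: zero_series_decaying.
  + exact: zero_series_even.
  + by move=> tau xi; rewrite Ea a0 /zero_series; ring.
  move=> b b2 Hb Eb; apply: (linearized_zero b b2) => // xi.
  by rewrite Eb Ea a0; ring.
- by apply: Or32 => tau xi; rewrite Ea aS.
by apply: Or33 => tau xi; rewrite Ea aS.
Qed.

(** Only the square of v_1 enters the linearized equation, so both signs reduce to the linearization
    at S. *)
Lemma solution_unique_sign sg u v : sg ^ 2 = 1 ->
  formal_solution gm u -> periodic_decaying u -> even_even u ->
  formal_solution gm v -> periodic_decaying v -> even_even v ->
  (forall tau xi, u 1%nat tau xi = sg * soliton (lambda gm) xi * cos tau) ->
  (forall tau xi, v 1%nat tau xi = sg * soliton (lambda gm) xi * cos tau) -> u = v.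
Proof.
move=> sg2 su pu eu sv pv ev Eu Ev.
apply: (solution_unique gm v sv pv ev) => // [tau xi|b b2 Hb Eb]; first by rewrite Eu Ev.
apply: (linearized_soliton _ lambda_gt0 b b2) => // xi.
by rewrite Eb Ev cos_0 Rmult_1_r (Rpow_mult_distr sg) sg2 Rmult_1_l.
Qed.
End Main.

Theorem theorem1 (g : C -> C) (gm : nat -> R)
    (g_series : forall z : C,
       @is_pseries C_AbsRing C_NormedModule (fun m => RtoC (gm m)) z (g z))
    (g_0 : g (RtoC 0%R) = RtoC 0%R)
    (g'_0 : @is_derive C_AbsRing C_NormedModule g (RtoC 0%R) (RtoC 1%R))
    (g_1 : gm 1%nat = 1%R)
    (lambda_gt0 : (0 < lambda gm)%R) :
  exists vp vm : fseries,
    vp <> vm /\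
    (forall v : fseries,
       (formal_solution gm v /\ nonzero_series v /\
        periodic_decaying v /\ even_even v)
       <-> (v = vp \/ v = vm)) /\
    (forall tau xi : R,
       vp 1%nat tau xi = (soliton (lambda gm) xi * cos tau)%R) /\
    (forall tau xi : R,
       vm 1%nat tau xi = (- soliton (lambda gm) xi * cos tau)%R) /\
    (forall k : nat, (1 <= k)%nat ->
       has_soliton_expansion (lambda gm) k (vp k) /\
       has_soliton_expansion (lambda gm) k (vm k)).
Proof.
Local Open Scope R_scope.
have sgp : 1 ^ 2 = 1 by ring.
have sgm : (-1) ^ 2 = 1 by ring.
have [vp [sp p1 tp]] := solution_exists gm lambda_gt0 1 sgp.
have [vm [sm m1 tm]] := solution_exists gm lambda_gt0 (-1) sgm.
have S0 := soliton_gt0 _ lambda_gt0 0.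
have [dp ep] := (tp_periodic_decaying gm lambda_gt0 vp tp, tp_even gm vp tp).
have [dm em] := (tp_periodic_decaying gm lambda_gt0 vm tm, tp_even gm vm tm).
exists vp, vm; split.
  move=> E; have := p1 0 0; rewrite E m1 cos_0; lra.
split.
  move=> v; split=> [[sv [nz [dv ev]]]|].
    have [v0|v1|v1] := solution_trichotomy gm lambda_gt0 v sv dv ev.
    - by have [k [tau [xi]]] := nz; rewrite v0 /zero_series.
    - left; apply: (solution_unique_sign gm lambda_gt0 1) => // tau xi.
      by rewrite v1 Rmult_1_l.
    right; apply: (solution_unique_sign gm lambda_gt0 (-1)) => // tau xi.
    by rewrite v1; ring.
  case=> ->; split=> //; split=> //; exists 1%nat, 0, 0.
    by rewrite p1 cos_0; lra.
  by rewrite m1 cos_0; lra.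
split=> [tau xi|]; first by rewrite p1 Rmult_1_l.
split=> [tau xi|k _]; first by rewrite m1; ring.
by split; apply: tp_expansion.
Qed.
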